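(* Let $d=1$, let $(\Omega,\mathcal H,\mathcal E)$ be a convex expectation space and let $(\xi_n)_{n\in\mathbb N}\subset\mathcal H$ be an iid sequence of random variables $\xi_n\colon\Omega\to\mathbb R$ with $\mathcal E[b\xi_1]=0$ for all $b\in\mathbb R$ and $\lim_{c\to\infty}\mathcal E[(|\xi_1|^2-c)^+]=0$. Suppose that there exist $a\ge 0$ and $p\ge 1$ with $$\mathcal E[\lambda(c_1|\xi_1|^2+c_2|\xi_1|^3)]\le a\lambda^p\,\mathcal E[c_1|\xi_1|^2+c_2|\xi_1|^3]\quad\text{for all } c_1,c_2\ge 0\text{ and }\lambda\ge 1 .$$ Furthermore, let $\mathcal E[c\,\xi_1^3]=0$ for all $c\in\mathbb R$ and $\mathcal E[c\,\xi_1^4]<\infty$ for all $c\ge 0$. Let $\mathcal E[f(\zeta)]:=(S(1)f)(0)$ for $f\in C_b$, where $(S(t))_{t\ge 0}$ is the semigroup described in the context. Then, for every $r\ge 1$, $f\in\mathrm{Lip}_b(r)$ and $n\in\mathbb N$, $$-c_r^-n^{-\gamma}\le\frac1n\mathcal E\Big[nf\Big(\frac1{\sqrt n}\sum_{i=1}^n\xi_i\Big)\Big]-\mathcal E[f(\zeta)]\le c_r^+n^{-\gamma}\quad\text{with}\quad\gamma:=\frac1{2+2p},$$ where, with $c_r:=2r+a\,\mathcal E[\tfrac12|\xi_1|^2]b_{0,1}^pr^p$, $$\begin{aligned}c_r^-:=\;&8r+3a\,\mathcal E\big[\tfrac12|\xi_1|^2\big]b_{0,1}^pr^p+2a\,\mathcal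 E\big[\tfrac12rb_{0,1}|\xi_1|^2\big]+a\,\mathcal E\big[\tfrac1{24}rb_{0,3}|\xi_1|^4+\tfrac12rb_{0,1}|\xi_1|^2\big]\\&+\mathcal E\big[\tfrac12\big((c_r+r)b_{1,2}+rb_{0,1}\big)|\xi_1|^2\big]+\tfrac12(c_r+r)b_{2,0},\\ c_r^+:=\;&8r+3a\,\mathcal E\big[\tfrac12|\xi_1|^2\big]b_{0,1}^pr^p+2a\,\mathcal E\big[\tfrac12rb_{0,1}|\xi_1|^2\big]+a\,\mathcal E\big[\tfrac1{24}rb_{0,3}|\xi_1|^4+\tfrac12rb_{0,1}|\xi_1|^2\big]\\&+\mathcal E\big[\tfrac12\big((2c_r+r)b_{1,2}+rb_{0,1}\big)|\xi_1|^2\big]+\tfrac12(2c_r+r)b_{2,0}.\end{aligned}$$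
   Context: A convex expectation space $(\Omega,\mathcal H,\mathcal E)$ consists of a set $\Omega$, a linear space $\mathcal H$ of functions $X\colon\Omega\to\mathbb R$ containing the constants and $|X|$ for each $X\in\mathcal H$, and a functional $\mathcal E\colon\mathcal H\to\mathbb R$ that is monotone, convex and satisfies $\mathcal E[c]=c$ for constants $c$. It is assumed that $f(X)\in\mathcal H$ for bounded continuous $f$ and random vectors $X$ with components in $\mathcal H$. A condition such as $\mathcal E[c\,\xi_1^4]<\infty$ includes the requirement $\xi_1^4\in\mathcal H$; all random variables to which $\mathcal E$ is applied are understood to belong to $\mathcal H$. The sequence $(\xi_n)$ is iid if $\mathcal E[f(\xi_n)]=\mathcal E[f(\xi_1)]$ for all $n$ and bounded continuous $f$, and each $\xi_{n+1}$ is independent of $(\xi_1,\dots,\xi_n)$, i.e. $\mathcal E[f(\xi_1,\dots,\xi_n,\xi_{n+1})]=\mathcal E\big[\mathcal E[f(x,\xi_{n+1})]|_{x=(\xi_1,\dots,\xi_n)}\big]$ for all bounded continuous $f\colon\mathbb R^{n+1}\to\mathbb R$. $C_b$ is the space of bounded continuous functions $\mathbb R\to\mathbb R$ with the mixed topology (a sequence converges iff it is uniformly bounded and converges uniformly on compact sets); $C_b^2$ is the set of twice continuously differentiable $f\in C_b$ with bounded first and second derivatives; $\mathrm{Lip}_b(r)$ is the set of $r$-Lipschitz $f\colon\mathbb R\to\mathbb R$ with $\sup|f|\le r$. Semigroup. Put $I(0):=\mathrm{id}$ and $(I(t)f)(x):=t\,\mathcal E[\tfrac1tf(x+\sqrt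 t\,\xi_1)]$ for $t>0$, $f\in C_b$. It is known (under the first-moment and uniform integrability conditions on $\xi_1$ above) that $S(t)f:=\lim_{n\to\infty}I(\tfrac1n)^{\lfloor nt\rfloor}f$ exists in $C_b$ for all $t\ge 0$, $f\in C_b$, and that $(S(t))_{t\ge 0}$ is the unique strongly continuous convex monotone semigroup on $C_b$ whose generator satisfies $(Af)(x)=\mathcal E[\tfrac12f''(x)\xi_1^2]$ for $f\in C_b^2$, $x\in\mathbb R$. $\eta\colon\mathbb R_+\times\mathbb R\to\mathbb R_+$ (with $\mathbb R_+=[0,\infty)$) is a fixed infinitely differentiable function with support in $[0,1]\times[-1,1]$ and integral $1$, and $b_{k,l}:=\|\partial_t^k\partial_x^l\eta\|_{L^1(\mathbb R_+\times\mathbb R)}$ for $k,l\in\mathbb N_0$. *)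

(* Defs.v *)
From mathcomp Require Export all_boot all_order all_algebra.
From mathcomp Require Export all_classical all_reals all_analysis.

Set Implicit Arguments.
Unset Strict Implicit.
Unset Printing Implicit Defensive.

Export Order.TTheory GRing.Theory Num.Theory.
Export numFieldNormedType.Exports.

#[global] Open Scope classical_set_scope.
#[global] Open Scope ring_scope.

Section BoundedContinuous.
Context {R : realType}.

Definition Cb (T : topologicalType) : set (T -> R) :=
  [set f | continuous f /\ bounded_fun f].

Definition Lip_b (r : R) : set (R -> R) :=
  [set f | r.-lipschitz_setT f /\ forall x, `|f x| <= r].

(* Sequential convergence in the mixed topology on Cb. *)
Definition mixed_cvg (u : nat -> R -> R) (g : R -> R) : Prop :=
  (exists M : R, forall n x, `|u n x| <= M) /\
  {family compact, u @ \oo --> g}.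

End BoundedContinuous.
Arguments Cb {R} T.

Section ConvexExpectation.
Context {R : realType} {Omega : Type}.
Implicit Types (H : set (Omega -> R)) (E : (Omega -> R) -> R).

(* The expectation is a total function, whose values outside H play no role. *)
Record convex_expectation_space H E : Prop := {
  ces_cst : forall c : R, H (fun=> c);
  ces_lin : forall (c : R) X Y, H X -> H Y -> H (fun w => c * X w + Y w);
  ces_abs : forall X, H X -> H (fun w => `|X w|);
  ces_comp : forall (k : nat) (f : 'rV[R]_k -> R) (X : 'I_k -> Omega -> R),
    Cb _ f -> (forall i, H (X i)) -> H (fun w => f (\row_i X i w));
  ces_mono : forall X Y, H X -> H Y -> (forall w, X w <= Y w) -> E X <= E Y;
  ces_convex : forall (l : R) X Y, 0 <= l <= 1 -> H X -> H Y ->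
    E (fun w => l * X w + (1 - l) * Y w) <= l * E X + (1 - l) * E Y;
  ces_Ecst : forall c : R, E (fun=> c) = c
}.

(* Y is independent of the random vector X; this relation is not symmetric. *)
Definition indep_of E (k : nat) (X : 'I_k -> Omega -> R) (Y : Omega -> R) :=
  forall f : 'rV[R]_(k + 1) -> R, Cb _ f ->
    E (fun w => f (row_mx (\row_i X i w) (const_mx (Y w)))) =
    E (fun w => E (fun w' => f (row_mx (\row_i X i w) (const_mx (Y w'))))).

(* Sequences are indexed from 0: xi n stands for $\xi_{n+1}$. *)
Definition iid E (xi : nat -> Omega -> R) : Prop :=
  (forall n (f : R -> R), Cb _ f ->
     E (fun w => f (xi n w)) = E (fun w => f (xi 0%N w))) /\
  (forall n, indep_of E (fun i : 'I_n.+1 => xi i) (xi n.+1)).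

(* The one-step operator I(t), with X in the role of $\xi_1$. *)
Definition chernoff_step E (X : Omega -> R) (t : R) (f : R -> R) : R -> R :=
  if t == 0 then f
  else fun x => t * E (fun w => t^-1 * f (x + Num.sqrt t * X w)).

(* S(t)f, the limit in Cb of I(1/n)^(floor(n t)) f; the limit is unique when it
   exists. *)
Definition chernoff_limit E (X : Omega -> R) (t : R) (f : R -> R) : R -> R :=
  get [set g : R -> R | Cb _ g /\
    mixed_cvg
      (fun n => iter (Num.truncn (n%:R * t)) (chernoff_step E X n%:R^-1) f) g].

(* $\mathcal E[f(\zeta)] = (S(1)f)(0)$ *)
Definition E_zeta E (X : Omega -> R) (f : R -> R) : R :=
  chernoff_limit E X 1 f 0.

End ConvexExpectation.

(* A function on the closed half-plane $\mathbb R_+\times\mathbb R$ is encoded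
   as a total function on R * R, of which only the values at points with
   nonnegative first coordinate are used: the derivative in time is one-sided
   at time 0. *)
Section Kernel.
Context {R : realType}.
Implicit Types g eta : R * R -> R.

Definition half_plane : set (R * R) := [set z | 0 <= z.1].

Definition time_quotient g (z : R * R) : set_system R :=
  (fun h => h^-1 * (g (z.1 + h, z.2) - g z)) @
    within [set h | 0 <= z.1 + h] 0^'.

Definition dt g : R * R -> R := fun z => lim (time_quotient g z).

Definition dx g : R * R -> R := fun z => derive1 (fun x => g (z.1, x)) z.2.

(* The iterated partial derivative along a word in {dt, dx}. *)
Definition dword (w : seq bool) g : R * R -> R :=
  foldr (fun b : bool => if b then dt else dx) g w.

Definition smooth_half_plane g : Prop := forall w : seq bool,
  [/\ {within half_plane, continuous (dword w g)},
      forall z, half_plane z -> cvg (time_quotient (dword w g) z) &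
      forall z, half_plane z ->
        derivable (fun x => dword w g (z.1, x)) z.2 1].

Local Notation lebesgue2 :=
  (@lebesgue_measure R \x @lebesgue_measure R)%E.

Record mollifier eta : Prop := {
  mollifier_smooth : smooth_half_plane eta;
  mollifier_ge0 : forall z, half_plane z -> 0 <= eta z;
  mollifier_supp : closure [set z | half_plane z /\ eta z != 0] `<=`
    `[0, 1] `*` `[-1, 1];
  mollifier_int : (\int[lebesgue2]_(z in half_plane) (eta z)%:E = 1)%E
}.

(* $b_{k,l}$ *)
Definition kernel_norm eta (k l : nat) : R :=
  \int[lebesgue2]_(z in half_plane) `|iter k dt (iter l dx eta) z|.

End Kernel.

Section Constants.
Context {R : realType} {Omega : Type}.
Variables (E : (Omega -> R) -> R) (X : Omega -> R) (b : nat -> nat -> R).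
Variables (a p r : R).

Definition c_lip : R :=
  2 * r + a * E (fun w => 2^-1 * `|X w| ^+ 2) * b 0 1 `^ p * r `^ p.

Definition c_minus : R :=
  8 * r + 3 * a * E (fun w => 2^-1 * `|X w| ^+ 2) * b 0 1 `^ p * r `^ p
  + 2 * a * E (fun w => 2^-1 * r * b 0 1 * `|X w| ^+ 2)
  + a * E (fun w => 24^-1 * r * b 0 3 * `|X w| ^+ 4
                    + 2^-1 * r * b 0 1 * `|X w| ^+ 2)
  + E (fun w => 2^-1 * ((c_lip + r) * b 1 2 + r * b 0 1) * `|X w| ^+ 2)
  + 2^-1 * (c_lip + r) * b 2 0.

Definition c_plus : R :=
  8 * r + 3 * a * E (fun w => 2^-1 * `|X w| ^+ 2) * b 0 1 `^ p * r `^ p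
  + 2 * a * E (fun w => 2^-1 * r * b 0 1 * `|X w| ^+ 2)
  + a * E (fun w => 24^-1 * r * b 0 3 * `|X w| ^+ 4
                    + 2^-1 * r * b 0 1 * `|X w| ^+ 2)
  + E (fun w => 2^-1 * ((2 * c_lip + r) * b 1 2 + r * b 0 1) * `|X w| ^+ 2)
  + 2^-1 * (2 * c_lip + r) * b 2 0.

End Constants.

(* Main.v *)
Require Import Defs.
From mathcomp Require Import measurable_realfun ring lra.

(** The normalised n-step expectation is I(1/n)^n f (0) for the one-step operator
    I(t), so it suffices to compare I(1/n)^n f with I(1/(nk))^(nk) f uniformly in k:
    this yields both the existence of the limit defining E[f(zeta)] and the rate.
    Put e = n^(-gamma). One of the two discrete evolutions is mollified in space at
    scale e by three Steklov averages, and in time over about sqrt n coarse steps by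
    two finite averages. By convexity (Jensen) it becomes a supersolution of its own
    scheme. A fourth order Taylor expansion, whose terms of order 1 and 3 are not
    seen by E, turns it into a supersolution of the other scheme, up to a second
    time difference and a multiple of xi^4.

    The scaling hypothesis does not control multiples of xi^4. This term is removed
    by applying convexity once to the whole iteration, whose values are bounded by r,
    instead of once per step. The Hoelder regularity in time follows from quadratic
    barriers. The kernel eta is not used for mollifying; it enters only through the
    bounds b_{0,1} >= 1, b_{0,3} >= 6, b_{1,2} >= 0 and b_{2,0} >= 0. *)

Set Implicit Arguments.
Unset Strict Implicit.
Unset Printing Implicit Defensive.

(** * Steklov averages *)

Section Steklov.
Context {R : realType}.
Implicit Types (g v F G : R -> R) (x y z r d c C K s a e : R).

(** The rate balances several errors. Averaging costs a multiple of r e in space, and in time r^2 /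
    (4 B) + n^(-1/2) mom2 B for any B > 0, the window in time having length about n^(-1/2). With B =
    r / (4 e) the first summand is r e, and the scaling hypothesis bounds mom2 B by a multiple of
    e^(-p); equating n^(-1/2) e^(-p) with e gives e = n^(-1/(2+2p)). The quartic remainder has a
    coefficient of order n^(-1) e^(-3); removing it with weight s = e turns this into n^(-1) e^(-4),
    which stays bounded because n^(-1) = e^(2+2p) and p >= 1. Jensen's inequality yields
    supersolutions, never subsolutions. So one mollified evolution cannot bound the other from both
    sides: for each inequality the evolution on the larger side is mollified. The stated constants
    carry a factor a on the fourth moment, the rate proved here carries 1. For a >= 1 this is
    harmless; for a < 1 scaling with lambda = 1 makes all second moments vanish, and every iterate
    equals f. *)

Definition lipb r g : Prop :=
  (forall x y, `|g x - g y| <= r * `|x - y|) /\ (exists M, forall x, `|g x| <= M).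

Lemma lipb_ge0 r g : lipb r g -> 0 <= r.
Proof. by move=> [gr _]; have := gr 1 0; rewrite subr0 normr1 mulr1; apply: le_trans. Qed.

Lemma lipb_dist r g : lipb r g -> forall x y, `|g x - g y| <= r * `|x - y|.
Proof. by move=> [gr _]. Qed.

Lemma lipb_continuous r g : lipb r g -> continuous g.
Proof.
move=> gr; have r0 := lipb_ge0 gr; move=> x; apply/cvgrPdist_le => e e0.
have e1 : 0 < e / (r + 1) by rewrite divr_gt0//; lra.
near=> y; apply: le_trans (lipb_dist gr _ _) _.
have : `|x - y| < e / (r + 1).
  near: y; exact: (@cvgr_dist_lt _ _ _ _ _ id x cvg_id _ e1).
move=> /ltW h; have r1 : 0 < r + 1 by lra.
rewrite ler_pdivlMr// in h; have := normr_ge0 (x - y); nra.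
Unshelve. all: by end_near. Qed.

Lemma ler_invS_limit a b K : (forall N : nat, a <= b + K / N.+1%:R) -> a <= b.
Proof.
move=> h; apply/ler_addgt0Pr => e e0.
apply: le_trans (h (Num.truncn (`|K| / e))) _; rewrite lerD2l.
rewrite ler_pdivrMr ?ltr0n//; apply: le_trans (ler_norm K) _.
by rewrite mulrC -ler_pdivrMr//; apply/ltW/truncnS_gt.
Qed.

Lemma ler_approx s1 a1 e1 s2 a2 e2 c : `|s1 - a1| <= e1 -> `|s2 - a2| <= e2 ->
  a1 <= a2 + c -> s1 <= s2 + c + (e1 + e2).
Proof. by rewrite !ler_norml => /andP[_ ?] /andP[? _] ?; lra. Qed.

Lemma is_derive_continuous G g : (forall x, is_derive x 1 G (g x)) -> continuous G.
Proof.
by move=> dG x; apply/differentiable_continuous/derivable1_diffP; have [] := dG x.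
Qed.

(** Integrals over [[a, x]] vanish for x < a, so the base point has to lie to the left of both 0 and
    x. It is taken as - |x| - 1, and the increment [F a x - F a 0] is the same for all such base
    points. *)
Lemma continuous_primitive g : continuous g ->
  exists G, forall x, is_derive x 1 G (g x).
Proof.
move=> cg.
have ig a b : lebesgue_measure.-integrable `[a, b] (EFin \o g).
  apply: continuous_compact_integrable; first exact: segment_compact.
  exact: continuous_subspaceT.
pose F a x := \int[lebesgue_measure]_(t in `[a, x]) g t.
exists (fun x => F (- `|x| - 1) x - F (- `|x| - 1) 0) => x.
have FE a b z : a <= b -> b < 0 -> b < z -> F a z - F a 0 = F b z - F b 0.
  move=> ab b0 bz.
  have h u : b < u -> F a u - F a b = F b u.
    move=> bu; rewrite /F Rintegral_itvB; [|exact: ig|by rewrite bnd_simp|by rewrite bnd_simp ltW].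
    rewrite Rintegral_itv_obnd_cbnd//.
    by apply: integrableS (ig b u) => //; apply: subset_itv_oc_cc.
  by have := h _ b0; have := h _ bz; lra.
pose N := - `|x| - 2.
have Nx : N < x by have := ler_norm (- x); rewrite normrN /N; lra.
have N0 : N < 0 by have := normr_ge0 x; rewrite /N; lra.
have [dF F'] : derivable (F N) x 1 /\ derive1 (F N) x = g x.
  apply: (@continuous_FTC1_closed _ _ _ _ (x + 1)) => //.
  - by lra.
  - exact: cg.
have D : is_derive x 1 (fun z => F N z - F N 0) (g x).
  rewrite -[g x]subr0; apply: is_deriveB.
  by split; [exact: dF|rewrite -derive1E; exact: F'].
apply: near_eq_is_derive D.
near=> z; have zN : N < z by near: z; exact: lt_nbhsr.
have zz : - `|z| - 1 < z by have := ler_norm (- z); rewrite normrN; lra.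
have z0 : - `|z| - 1 < 0 by have := normr_ge0 z; lra.
have [h|h] := leP N (- `|z| - 1); first exact: FE.
by apply/esym; apply: FE => //; exact: ltW.
Unshelve. all: by end_near. Qed.

Lemma is_derive_powZ C z k :
  is_derive z 1 (fun z => C / k.+1%:R * z ^+ k.+1) (C * z ^+ k).
Proof.
have d : is_derive z 1 (@GRing.exp R ^~ k.+1) (k.+1%:R * z ^+ k).
  by split; [exact: exprn_derivable|rewrite exp_derive/= /GRing.scale/= mulr1].
have := is_deriveZ (C / k.+1%:R) d.
by rewrite /GRing.scale /= mulrA divfK.
Qed.

(** One integration of a remainder estimate, by the mean value theorem for the difference with C /
    (k + 1) y^(k+1). Three uses give the Taylor remainder with 2 * 3 * 4 = 24. *)
Lemma derive_pow_bound F F' C k : 0 <= C -> (forall y, is_derive y 1 F (F' y)) ->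
  F 0 = 0 -> (forall y, `|F' y| <= C * `|y| ^+ k) ->
  forall y, `|F y| <= C / k.+1%:R * `|y| ^+ k.+1.
Proof.
move=> C0.
have pos (G g : R -> R) : (forall y, is_derive y 1 G (g y)) -> G 0 = 0 ->
    (forall y, `|g y| <= C * `|y| ^+ k) ->
    forall y, 0 <= y -> G y <= C / k.+1%:R * y ^+ k.+1.
  move=> dG G0 bg y y0.
  pose H z := C / k.+1%:R * z ^+ k.+1 - G z.
  have dH z : is_derive z 1 H (C * z ^+ k - g z).
    exact: (is_deriveB (is_derive_powZ C z k) (dG z)).
  have [c] := MVT_segment y0 (fun x _ => dH x)
    (continuous_subspaceT (is_derive_continuous dH)).
  rewrite in_itv/= => /andP[c0 _].
  rewrite {2}/H expr0n/= G0 mulr0 !subr0 => e.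
  rewrite -subr_ge0 -/(H y) e mulr_ge0// subr_ge0.
  by apply: le_trans (ler_norm _) _; apply: le_trans (bg c) _; rewrite ger0_norm.
move=> dF F0 bF y.
have dN g g' : (forall y, is_derive y 1 g (g' y)) ->
    forall y, is_derive y 1 (fun z => - g z) (- g' y).
  by move=> dg z; exact: is_deriveN.
have dO g g' : (forall y, is_derive y 1 g (g' y)) ->
    forall y, is_derive y 1 (fun z => g (- z)) (- g' (- y)).
  move=> dg z; rewrite -mulrN1.
  exact: (@is_derive1_comp _ g -%R _ _ _ (dg (- z)) (is_deriveNid z 1)).
have [y0|y0] := leP 0 y.
  rewrite ler_norml lerNl (ger0_norm y0); apply/andP; split.
    apply: (pos _ _ (dN _ _ dF)) => //; first by rewrite F0 oppr0.
    by move=> z; rewrite normrN.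
  exact: (pos _ _ dF).
have {}y0 : 0 <= - y by lra.
rewrite -[in F y](opprK y) -[`|y|]normrN ler_norml lerNl (ger0_norm y0); apply/andP; split.
  apply: (pos _ _ (dN _ _ (dO _ _ dF))) => //; first by rewrite oppr0 F0 oppr0.
  by move=> z; rewrite opprK -[`|z|]normrN.
apply: (pos _ _ (dO _ _ dF)) => //; first by rewrite oppr0.
by move=> z; rewrite normrN -[`|z|]normrN.
Qed.

Definition prim g := get [set G : R -> R | forall x, is_derive x 1 G (g x)].

Lemma primP r g : lipb r g -> forall x, is_derive x 1 (prim g) (g x).
Proof.
move=> /lipb_continuous/continuous_primitive[G dG].
exact: (@getI _ [set G : R -> R | forall x, is_derive x 1 G (g x)] G).
Qed.

(** The average of g over [x - d, x + d]. Written through a primitive, it has the difference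
    quotient [cdiff] of g as derivative. *)
Definition stek d g x := (2 * d)^-1 * (prim g (x + d) - prim g (x - d)).

Definition node d (N : nat) (i : nat) x := x - d + 2 * d * i%:R / N.+1%:R.

(** By the mean value theorem the error is the oscillation of g on one cell of the partition. Finite
    sums are what the convexity of an expectation applies to. *)
Lemma stek_avg r d g (N : nat) x : 0 < d -> lipb r g ->
  `|stek d g x - N.+1%:R^-1 * \sum_(i < N.+1) g (node d N i x)|
    <= 2 * d * r / N.+1%:R.
Proof.
move=> d0 gr; pose P := prim g; pose y i := node d N i x.
have N0 : (N.+1%:R : R) != 0 by [].
have -> : stek d g x = \sum_(i < N.+1) (2 * d)^-1 * (P (y i.+1) - P (y i)).
  rewrite -mulr_sumr -(big_mkord xpredT (fun i => P (y i.+1) - P (y i))).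
  rewrite telescope_sumr// /y /node mulfK// mulr0 mul0r addr0 /stek.
  by congr (_ * (_ - _)); congr prim; ring.
rewrite mulr_sumr -sumrB; apply: le_trans (ler_norm_sum _ _ _) _.
have -> : 2 * d * r / N.+1%:R = \sum_(i < N.+1) (2 * d * r / N.+1%:R / N.+1%:R).
  by rewrite sumr_const card_ord -[RHS]mulr_natr divfK.
apply: ler_sum => i _.
have hy : y i.+1 - y i = 2 * d / N.+1%:R.
  by rewrite /y /node -natr1; field.
have hp : 0 < 2 * d / N.+1%:R by rewrite divr_gt0// ?ltr0n//; lra.
have yy : y i <= y i.+1 by rewrite -subr_ge0 hy ltW.
have [c] := MVT_segment yy (fun x _ => primP gr x)
    (continuous_subspaceT (is_derive_continuous (primP gr))).
rewrite in_itv/= => /andP[c1 c2] ->; rewrite hy.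
have -> : (2 * d)^-1 * (g c * (2 * d / N.+1%:R)) - N.+1%:R^-1 * g (y i)
  = N.+1%:R^-1 * (g c - g (y i)) 
    by move: (g c) (g (y i)) (N.+1%:R : R) N0 => u v n n0; field; rewrite n0 (gt_eqF d0).
rewrite normrM ger0_norm ?invr_ge0 ?ler0n// mulrC ler_pM2r ?invr_gt0 ?ltr0n//.
apply: le_trans (lipb_dist gr _ _) _; rewrite ger0_norm; last lra.
have := lipb_ge0 gr; move: hp hy c1 c2; set t := _ / _; set a := y _; set b := y _.
rewrite (_ : 2 * d * r / N.+1%:R = r * t); last by rewrite /t; field.
by move=> *; apply: ler_wpM2l => //; lra.
Qed.

Lemma stek_le r r' d g1 g2 c : 0 < d -> lipb r g1 -> lipb r' g2 ->
  (forall x, g1 x <= g2 x + c) -> forall x, stek d g1 x <= stek d g2 x + c.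
Proof.
move=> d0 g1r g2r g12 x.
apply: (@ler_invS_limit _ _ (2 * d * r + 2 * d * r')) => N.
rewrite mulrDl.
apply: ler_approx (stek_avg N x d0 g1r) (stek_avg N x d0 g2r) _.
rewrite -lerBlDl -mulrBr mulrC ler_pdivrMr ?ltr0n// -sumrB.
have -> : c * N.+1%:R = \sum_(i < N.+1) c by rewrite sumr_const card_ord -[RHS]mulr_natr.
by apply: ler_sum => i _; rewrite lerBlDl.
Qed.

Lemma stek_dist r d g : 0 < d -> lipb r g -> forall x, `|stek d g x - g x| <= r * d / 2.
Proof.
move=> d0 gr x; pose P := prim g.
pose F y := P (y + x) - P x - g x * y.
have dF y : is_derive y 1 F (g (y + x) - g x).
  have h1 : is_derive y 1 (fun y => P (y + x)) (g (y + x)).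
    rewrite -[g (y + x)]mulr1.
    exact: (@is_derive1_comp _ P (shift x) _ _ _ (primP gr (y + x)) (is_derive_shift _ _ _)).
  have h2 : is_derive y 1 (fun y => P (y + x) - P x) (g (y + x) - 0).
    exact: is_deriveB.
  rewrite subr0 in h2.
  have h3 : is_derive y 1 (fun y => g x * y) (g x).
    by have := is_deriveZ (g x) (is_derive_id y 1); rewrite /GRing.scale/= mulr1.
  exact: is_deriveB h2 h3.
have F0 : F 0 = 0 by rewrite /F add0r subrr mulr0 subr0.
have bF y : `|F y| <= r / 2 * `|y| ^+ 2.
  apply: (derive_pow_bound (lipb_ge0 gr) dF F0) => z.
  by rewrite expr1 -[X in _ * `|X|](addrK x z); exact: lipb_dist.
have -> : stek d g x - g x = (2 * d)^-1 * (F d - F (- d)).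
  by rewrite /stek /F [d + x]addrC [- d + x]addrC -/P; field; rewrite ?(gt_eqF d0).
rewrite normrM ger0_norm; last by rewrite invr_ge0; lra.
have := bF d; have := bF (- d); rewrite normrN (gtr0_norm d0) => h1 h2.
rewrite mulrC ler_pdivrMr; last lra.
apply: le_trans (ler_normB _ _) _; lra.
Qed.

Lemma stek_lipb r d g : 0 < d -> lipb r g -> lipb r (stek d g).
Proof.
move=> d0 gr; split; last first.
  have [_ [M gM]] := gr; exists (M + r * d / 2) => x.
  rewrite -(subrK (g x) (stek d g x)) addrC; apply: le_trans (ler_normD _ _) _.
  by apply: lerD; [exact: gM|exact: stek_dist].
suff h x y : stek d g x - stek d g y <= r * `|x - y|.
  move=> x y; rewrite ler_norml h andbT lerNl opprB distrC; exact: h.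
rewrite lerBlDl.
apply: (@ler_invS_limit _ _ (2 * d * r + 2 * d * r)) => N.
rewrite mulrDl; apply: ler_approx (stek_avg N x d0 gr) (stek_avg N y d0 gr) _.
rewrite -lerBlDl -mulrBr mulrC ler_pdivrMr ?ltr0n// -sumrB.
have -> : r * `|x - y| * N.+1%:R = \sum_(i < N.+1) (r * `|x - y|).
  by rewrite sumr_const card_ord -[RHS]mulr_natr.
apply: ler_sum => i _; apply: le_trans (ler_norm _) _.
apply: le_trans (lipb_dist gr _ _) _; rewrite /node.
by rewrite (_ : _ - _ = x - y)//; ring.
Qed.

Definition cdiff d g x := (2 * d)^-1 * (g (x + d) - g (x - d)).

Lemma is_derive_cdiff d g g' : (forall x, is_derive x 1 g (g' x)) ->
  forall x, is_derive x 1 (cdiff d g) (cdiff d g' x).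
Proof.
move=> dg x.
have h c : is_derive x 1 (fun y => g (y + c)) (g' (x + c)).
  rewrite -[g' (x + c)]mulr1.
  exact: (@is_derive1_comp _ g (shift c) _ _ _ (dg (x + c)) (is_derive_shift _ _ _)).
exact: is_deriveZ (is_deriveB (h d) (h (- d))).
Qed.

Lemma is_derive_stek r d g : lipb r g ->
  forall x, is_derive x 1 (stek d g) (cdiff d g x).
Proof. by move=> gr; apply: is_derive_cdiff; exact: primP gr. Qed.

Lemma cdiff_lip r d g : 0 < d -> (forall x y, `|g x - g y| <= r * `|x - y|) ->
  forall x y, `|cdiff d g x - cdiff d g y| <= r / d * `|x - y|.
Proof.
move=> d0 gr x y; rewrite /cdiff -mulrBr normrM ger0_norm; last by rewrite invr_ge0; lra.
rewrite mulrC ler_pdivrMr; last lra.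
have -> : r / d * `|x - y| * (2 * d) = r * `|x - y| + r * `|x - y| by field; rewrite ?(gt_eqF d0).
have -> : g (x + d) - g (x - d) - (g (y + d) - g (y - d)) =
  (g (x + d) - g (y + d)) - (g (x - d) - g (y - d)) by ring.
apply: le_trans (ler_normB _ _) _; apply: lerD; apply: le_trans (gr _ _) _.
  by rewrite (_ : x + d - _ = x - y)//; ring.
by rewrite (_ : x - d - _ = x - y)//; ring.
Qed.

(** After three averages the third derivative is an iterated difference quotient of g itself, hence
    Lipschitz with constant r / d^3; a fourth order remainder needs no more. *)
Definition smooth d g := stek d (stek d (stek d g)).

Lemma smooth_le r r' d g1 g2 c : 0 < d -> lipb r g1 -> lipb r' g2 ->
  (forall x, g1 x <= g2 x + c) -> forall x, smooth d g1 x <= smooth d g2 x + c.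
Proof.
move=> d0 h1 h2 g12.
have k1 := stek_lipb d0 h1; have k2 := stek_lipb d0 h2.
exact: stek_le d0 (stek_lipb d0 k1) (stek_lipb d0 k2)
  (stek_le d0 k1 k2 (stek_le d0 h1 h2 g12)).
Qed.

Lemma smooth_lipb r d g : 0 < d -> lipb r g -> lipb r (smooth d g).
Proof. by move=> d0 gr; exact: stek_lipb d0 (stek_lipb d0 (stek_lipb d0 gr)). Qed.

Lemma smooth_dist r d g : 0 < d -> lipb r g ->
  forall x, `|smooth d g x - g x| <= 3 / 2 * r * d.
Proof.
move=> d0 gr x.
have g1r := stek_lipb d0 gr; have g2r := stek_lipb d0 g1r.
have h1 := stek_dist d0 gr x; have h2 := stek_dist d0 g1r x.
have h3 := stek_dist d0 g2r x.
have -> : smooth d g x - g x = (smooth d g x - stek d (stek d g) x) +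
  ((stek d (stek d g) x - stek d g x) + (stek d g x - g x)) by ring.
apply: le_trans (ler_normD _ _) _.
have h4 := ler_normD (stek d (stek d g) x - stek d g x) (stek d g x - g x).
rewrite /smooth; lra.
Qed.

Lemma smooth_taylor r d g x : 0 < d -> lipb r g -> exists c1 c2 c3, forall y,
  `|smooth d g (x + y) - smooth d g x - (c1 * y + c2 * y ^+ 2 + c3 * y ^+ 3)|
    <= r / d ^+ 3 / 24 * y ^+ 4.
Proof.
move=> d0 gr; have r0 := lipb_ge0 gr.
have g1r := stek_lipb d0 gr; have g2r := stek_lipb d0 g1r.
pose v3 := cdiff d (cdiff d (cdiff d g)).
pose v2 := cdiff d (cdiff d (stek d g)).
pose v1 := cdiff d (stek d (stek d g)).
have d3 : forall y, is_derive y 1 v2 (v3 y).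
  by do 2 apply: is_derive_cdiff; exact: is_derive_stek gr.
have d2 : forall y, is_derive y 1 v1 (v2 y).
  by apply: is_derive_cdiff; exact: is_derive_stek g1r.
have d1 : forall y, is_derive y 1 (smooth d g) (v1 y).
  exact: is_derive_stek g2r.
have v3r : forall y z, `|v3 y - v3 z| <= r / d ^+ 3 * `|y - z|.
  move=> y z; have -> : r / d ^+ 3 = r / d / d / d by field; rewrite ?(gt_eqF d0).
  by do 3 apply: cdiff_lip => //; exact: lipb_dist gr.
set C := r / d ^+ 3.
have C0 : 0 <= C by rewrite divr_ge0// exprn_ge0// ltW.
have sh (f f' : R -> R) a (k : R -> R) (k' : R -> R) :
    (forall y, is_derive y 1 f (f' y)) -> (forall y, is_derive y 1 k (k' y)) ->
    forall y, is_derive y 1 (fun y => f (y + x) - a - k y) (f' (y + x) - k' y).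
  move=> df dk y; apply: is_deriveB.
  rewrite -[f' (y + x)]subr0; apply: is_deriveB.
  rewrite -[f' (y + x)]mulr1.
  exact: (@is_derive1_comp _ f (shift x) _ _ _ (df (y + x)) (is_derive_shift _ _ _)).
pose k2 y := v3 x * y.
have dk2 y : is_derive y 1 k2 (v3 x).
  by have := is_deriveZ (v3 x) (is_derive_id y 1); rewrite /GRing.scale/= mulr1.
pose k1 y := v2 x * y + v3 x / 2 * y ^+ 2.
have dk1 y : is_derive y 1 k1 (v2 x + k2 y).
  apply: is_deriveD; last exact: (@is_derive_powZ (v3 x) y 1).
  by have := is_deriveZ (v2 x) (is_derive_id y 1); rewrite /GRing.scale/= mulr1.
pose k0 y := v1 x * y + v2 x / 2 * y ^+ 2 + v3 x / 2 / 3 * y ^+ 3.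
have dk0 y : is_derive y 1 k0 (v1 x + k1 y).
  rewrite /k1 addrA; apply: is_deriveD; last exact: (@is_derive_powZ (v3 x / 2) y 2).
  apply: is_deriveD; last exact: (@is_derive_powZ (v2 x) y 1).
  by have := is_deriveZ (v1 x) (is_derive_id y 1); rewrite /GRing.scale/= mulr1.
have b2 y : `|v2 (y + x) - v2 x - k2 y| <= C / 2 * `|y| ^+ 2.
  apply: (derive_pow_bound C0 (sh _ _ _ _ _ d3 dk2)); first by rewrite add0r /k2; ring.
  by move=> z; rewrite expr1; apply: le_trans (v3r _ _) _; rewrite addrK.
have b1 y : `|v1 (y + x) - v1 x - k1 y| <= C / 2 / 3 * `|y| ^+ 3.
  apply: (derive_pow_bound _ (sh _ _ _ _ _ d2 dk1)); first by lra.
    by rewrite add0r /k1; ring.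
  by move=> z; rewrite opprD addrA; exact: b2.
have b0 y : `|smooth d g (y + x) - smooth d g x - k0 y| <= C / 2 / 3 / 4 * `|y| ^+ 4.
  apply: (derive_pow_bound _ (sh _ _ _ _ _ d1 dk0)); first by lra.
    by rewrite add0r /k0; ring.
  by move=> z; rewrite opprD addrA; exact: b1.
exists (v1 x), (v2 x / 2), (v3 x / 2 / 3) => y.
rewrite [x + y]addrC; apply: le_trans (b0 y) _.
have -> : `|y| ^+ 4 = y ^+ 4 by rewrite -normrX ger0_norm// exprn_even_ge0.
by rewrite (_ : C / 2 / 3 / 4 = C / 24)//; field.
Qed.

End Steklov.

(** * Lower bounds for the norms of the kernel *)

Section PlaneMeasurability.
Context {R : realType}.

(** Measurability refers to the product sigma-algebra, so U is exhausted by the countably many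
    squares with rational centres and radii 1 / (n + 1) that it contains. *)
Lemma open_measurable_prod (U : set (R * R)) : open U -> measurable U.
Proof.
move=> oU.
pose B (i : rat * rat * nat) : set (R * R) :=
  ball (ratr i.1.1 : R) i.2.+1%:R^-1 `*` ball (ratr i.1.2 : R) i.2.+1%:R^-1.
have -> : U = \bigcup_i (if `[< B i `<=` U >] then B i else set0).
  apply/seteqP; split => [z Uz|z [i _]]; last by case: ifPn => [/asboolP h /h|].
  have /nbhs_ballP[e /= e0 eU] : nbhs z U by apply: open_nbhs_nbhs; split.
  pose n := Num.truncn (2 / e).
  have ne : 2 * n.+1%:R^-1 < e.
    rewrite mulrC -ltr_pdivlMl ?invr_gt0 ?ltr0n// invrK.
    by rewrite -ltr_pdivrMr// truncnS_gt.
  have nn : n.+1%:R^-1 + n.+1%:R^-1 <= e by rewrite -mulr2n -[leLHS]mulr_natl ltW.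
  have n0 : 0 < n.+1%:R^-1 :> R by rewrite invr_gt0 ltr0n.
  have rnear (x : R) : exists q : rat, ball (ratr q : R) n.+1%:R^-1 x.
    have b0 : ball x n.+1%:R^-1 !=set0 by exists x; exact: ballxx.
    have [y [xq [q _ qy]]] := @dense_rat R _ b0 (ball_open _ _).
    by exists q; rewrite qy; exact: ball_sym.
  have [q1 h1] := rnear z.1; have [q2 h2] := rnear z.2.
  have BU : B (q1, q2, n) `<=` U.
    move=> w [/= w1 w2]; apply: eU; split => /=.
      exact: le_ball nn _ (ball_triangle (ball_sym h1) w1).
    exact: le_ball nn _ (ball_triangle (ball_sym h2) w2).
  by exists (q1, q2, n) => //; rewrite asboolT.
apply: countable_bigcupT_measurable => [|i]; first exact: countableP.
case: ifP => // _.
by apply: measurableX; apply: open_measurable; apply: ball_open; rewrite invr_gt0 ltr0n.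
Qed.

Lemma open_measurable_subspace_prod (D : set (R * R)) (U : set (subspace D)) :
  measurable D -> open U -> measurable (D `&` U).
Proof.
move=> mD /open_subspaceP [V oV VD]; rewrite setIC -VD.
by apply: measurableI => //; exact: open_measurable_prod.
Qed.

Lemma subspace_continuous_measurable_prod (D : set (R * R)) (f : subspace D -> R) :
  measurable D -> continuous f -> measurable_fun D f.
Proof.
move=> mD /continuousP cf; apply: (measurability _ (RGenOpens.measurableE R)).
move=> _ [_ [a [b ->] <-]]; apply: open_measurable_subspace_prod => //.
exact/cf/interval_open.
Qed.

Lemma half_plane_measurable : measurable (@half_plane R).
Proof.
have -> : @half_plane R = [set x : R | 0 <= x] `*` setT.
  by apply/seteqP; split => [z|z []].
apply: measurableX => //; apply: closed_measurable; exact: closed_ge.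
Qed.

End PlaneMeasurability.

Section KernelBounds.
Context {R : realType}.
Variable eta : R * R -> R.
Hypothesis eta_m : mollifier eta.
Implicit Types (t x : R) (l : nat).

Lemma iter_dx_dword l : iter l dx eta = dword (nseq l false) eta.
Proof. by elim: l => //= l ->. Qed.

Lemma is_derive_iter_dx l t x : 0 <= t ->
  is_derive x 1 (fun y => iter l dx eta (t, y)) (iter l.+1 dx eta (t, x)).
Proof.
move=> t0; have [_ _ /(_ (t, x) t0) d] := mollifier_smooth eta_m (nseq l false).
rewrite -iter_dx_dword /= in d.
by split => //; rewrite iterS /dx/= derive1E.
Qed.

Lemma iter_dx_eq0 l t x : 0 <= t -> (1 < t) || (1 < `|x|) -> iter l dx eta (t, x) = 0.
Proof.
move=> t0; elim: l x => [|l ih] x tx.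
  apply/eqP; apply: contraT => /= n0.
  have : closure [set z | half_plane z /\ eta z != 0] (t, x).
    by apply: subset_closure.
  move/(mollifier_supp eta_m) => [/=]; rewrite !in_itv/= => /andP[_ t1] x1.
  by move: tx; rewrite ltNge t1/= ltNge ler_norml x1.
rewrite iterS /dx/= derive1E.
have -> : 'D_1 (fun y => iter l dx eta (t, y)) x = 'D_1 (cst (0 : R)) x.
  apply: near_eq_derive.
  case/orP: tx => [t1|x1]; first by exists 1 => //= y _; rewrite ih// t1.
  have h : \forall y \near x, 1 < `|y|.
    have : (fun y : R => `|y|) @ x --> `|x| by exact: norm_continuous.
    by move/cvgr_gt; apply.
  by apply: filterS h => y y1; rewrite ih// y1 orbT.
exact: derive_cst.
Qed.

Lemma integral_itv_iter_dx (f : R -> R) : (forall x, 1 < `|x| -> f x = 0) ->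
  (\int[lebesgue_measure]_x (f x)%:E =
   \int[lebesgue_measure]_(x in `[(-2)%R, 2%R]) (f x)%:E)%E.
Proof.
move=> f0; rewrite [RHS]integral_mkcond; apply: eq_integral => x _.
rewrite patchE; case: ifPn => //.
rewrite notin_setE/= in_itv/= => /negP h; rewrite f0//.
rewrite ltNge; apply: contra h; rewrite ler_norml; lra.
Qed.

(** Integration by parts in packaged form: F is a primitive of c eta + P d_x^l eta with equal values
    at both ends, so c eta and - P d_x^l eta have the same integral, and |P| <= 1 on the support. *)
Lemma integral_slice_le l (c : R) (P F : R -> R) t : 0 <= t -> 0 <= c ->
  continuous P -> (forall x, `|x| <= 1 -> `|P x| <= 1) ->
  (forall x, is_derive x 1 F (c * eta (t, x) + P x * iter l dx eta (t, x))) ->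
  F 2 = 0 -> F (- 2) = 0 ->
  (\int[lebesgue_measure]_x (c * eta (t, x))%:E <=
   \int[lebesgue_measure]_x `|iter l dx eta (t, x)|%:E)%E.
Proof.
move=> t0 c0 cP P1 dF F2 FN2.
have cg k : continuous (fun x => iter k dx eta (t, x)).
  move=> x; apply/differentiable_continuous/derivable1_diffP.
  by have [] := is_derive_iter_dx k x t0.
pose f x := c * eta (t, x) + P x * iter l dx eta (t, x).
have cf : continuous f.
  move=> x; apply: cvgD; first by apply: cvgM; [exact: cvg_cst|exact: (cg 0)].
  by apply: cvgM; [exact: cP|exact: cg].
have ca : continuous (fun x => `|iter l dx eta (t, x)|).
  by move=> x; apply: cvg_norm; exact: cg.
have ci (h : R -> R) : continuous h ->
    lebesgue_measure.-integrable `[(-2 : R), 2] (EFin \o h).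
  move=> ch; apply: continuous_compact_integrable; first exact: segment_compact.
  exact: continuous_subspaceT.
have cm (h : R -> R) : continuous h -> measurable_fun `[(-2 : R), 2] (EFin \o h).
  by move=> /ci /integrableP[].
rewrite integral_itv_iter_dx; last by move=> x x1; have /= -> := @iter_dx_eq0 0 t x t0; rewrite ?x1 ?orbT ?mulr0.
rewrite [leRHS]integral_itv_iter_dx; last first.
  by move=> x x1; rewrite iter_dx_eq0// ?x1 ?orbT// normr0.
have <- : (\int[lebesgue_measure]_(x in `[(-2)%R, 2%R])
    (`|iter l dx eta (t, x)|%:E + (f x)%:E) =
    \int[lebesgue_measure]_(x in `[(-2)%R, 2%R]) `|iter l dx eta (t, x)|%:E)%E.
  rewrite integralD//=; [|exact: ci ca|exact: ci cf].
  rewrite (@continuous_FTC2 _ f F)//; last 4 first.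
  - by lra.
  - exact: continuous_subspaceT.
  - have cF : continuous F.
      by move=> x; apply/differentiable_continuous/derivable1_diffP; have [] := dF x.
    split.
    + by move=> x _; have [] := dF x.
    + exact/cvg_at_right_filter/cF.
    + exact/cvg_at_left_filter/cF.
  - by move=> x _; rewrite derive1E; apply: derive_val.
  by rewrite F2 FN2 sube0 adde0.
apply: ge0_le_integral => //=.
- by move=> x _; rewrite lee_fin mulr_ge0// (mollifier_ge0 eta_m).
- apply: cm => x; apply: cvgM; [exact: cvg_cst|exact: (cg 0)].
- by apply: emeasurable_funD; [exact: cm ca|exact: cm cf].
- move=> x _; rewrite -EFinD lee_fin /f.
  suff : - (P x * iter l dx eta (t, x)) <= `|iter l dx eta (t, x)| by lra.
  have [x1|x1] := leP `|x| 1; last by rewrite iter_dx_eq0// ?x1 ?orbT// mulr0 oppr0 normr0.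
  apply: le_trans (ler_norm _) _; rewrite normrN normrM ler_piMl//; exact: P1.
Qed.

Lemma kernel_norm_ge0 k l : 0 <= kernel_norm eta k l.
Proof. by apply: Rintegral_ge0 => z _; exact: normr_ge0. Qed.

Lemma iter_dx_within l : {within half_plane, continuous (iter l dx eta)}.
Proof.
by have [+ _ _] := mollifier_smooth eta_m (nseq l false); rewrite -iter_dx_dword.
Qed.

Lemma iter_dx_bounded l : exists2 M, 0 <= M &
  forall z, half_plane z -> `|iter l dx eta z| <= M.
Proof.
pose K : set (R * R) := `[0, 1] `*` `[-1, 1].
have cK : compact K by apply: compact_setX; exact: segment_compact.
have sK : K `<=` half_plane.
  by move=> z [/= + _]; rewrite /half_plane/= in_itv/= => /andP[].
have wK : {within K, continuous (iter l dx eta)}.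
  exact: continuous_subspaceW sK (@iter_dx_within l).
have [M [_ hM]] := compact_bounded (continuous_compact wK cK).
exists (`|M| + 1) => // z z0.
have [zK|zK] := pselect (K z).
  by apply: hM; [have := ler_norm M; lra|exists z].
case: z z0 zK => t x t0 zK; rewrite iter_dx_eq0 ?normr0//.
apply: contrapT => /negP; rewrite negb_or -!leNgt => /andP[t1 x1]; apply: zK.
by split; rewrite /= in_itv/= -?ler_norml// t1 andbT.
Qed.

Lemma kernel_norm_ge l (c : R) (P : R -> R) (F : R -> R -> R) : 0 <= c ->
  continuous P -> (forall x, `|x| <= 1 -> `|P x| <= 1) ->
  (forall t x, 0 <= t ->
     is_derive x 1 (F t) (c * eta (t, x) + P x * iter l dx eta (t, x))) ->
  (forall t, 0 <= t -> F t 2 = 0) -> (forall t, 0 <= t -> F t (- 2) = 0) ->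
  c <= kernel_norm eta 0 l.
Proof.
move=> c0 cP P1 dF F2 FN2.
pose lambda2 := (@lebesgue_measure R \x @lebesgue_measure R)%E.
have mH := @half_plane_measurable R.
have mD k : measurable_fun half_plane (EFin \o iter k dx eta).
  apply/measurable_EFinP; apply: subspace_continuous_measurable_prod => //.
  exact: iter_dx_within.
have mA : measurable_fun half_plane (fun z => `|iter l dx eta z|%:E).
  by apply/measurable_EFinP; apply: measurableT_comp => //; apply/measurable_EFinP; exact: mD.
have mc : measurable_fun half_plane (fun z => (c * eta z)%:E).
  by apply/measurable_EFinP; apply: measurable_funM => //; apply/measurable_EFinP; exact: (mD 0).
have e0 z : half_plane z -> 0 <= eta z by exact: mollifier_ge0.
have low : (c%:E <= \int[lambda2]_(z in half_plane) `|iter l dx eta z|%:E)%E.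
  have -> : c%:E = (\int[lambda2]_(z in half_plane) (c * eta z)%:E)%E.
    under eq_integral do rewrite EFinM.
    rewrite ge0_integralZl_EFin//; last exact: (mD 0).
    by rewrite (mollifier_int eta_m) mule1.
  rewrite integral_mkcond [leRHS]integral_mkcond.
  rewrite !fubini_tonelli1//; last 4 first.
  - exact/(measurable_restrictT _ mH).
  - by move=> z; rewrite patchE; case: ifPn => // _; rewrite lee_fin.
  - exact/(measurable_restrictT _ mH).
  - move=> z; rewrite patchE; case: ifPn => // /set_mem zH.
    by rewrite lee_fin mulr_ge0// e0.
  apply: ge0_le_integral => //.
  - move=> t _; apply: integral_ge0 => x _.
    rewrite patchE; case: ifPn => // /set_mem zH.
    by rewrite lee_fin mulr_ge0// e0.
  - apply: measurable_fun_fubini_tonelli_F.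
      exact/(measurable_restrictT _ mH).
    move=> z; rewrite patchE; case: ifPn => // /set_mem zH.
    by rewrite lee_fin mulr_ge0// e0.
  - apply: measurable_fun_fubini_tonelli_F.
      exact/(measurable_restrictT _ mH).
    by move=> z; rewrite patchE; case: ifPn => // _; rewrite lee_fin.
  move=> t _; rewrite /fubini_F.
  have [t0|t0] := leP 0 t.
    have dFt x := dF t x t0.
    apply: etrans (integral_slice_le t0 c0 cP P1 dFt (F2 _ t0) (FN2 _ t0)).
    by congr (_ <= _)%E; apply: eq_integral => x _; rewrite patchE ifT// inE.
  apply: etrans (lexx (\int[@lebesgue_measure R]_x (0 : \bar R))%E).
  by congr (_ <= _)%E; apply: eq_integral => x _; rewrite patchE ifF//;
    apply/negP => /set_mem; rewrite /half_plane/= leNgt t0.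
(* The real-valued integral sends +oo to 0, so the lower bound passes to [kernel_norm] only once
   finiteness is known. *)
have fin : (\int[lambda2]_(z in half_plane) `|iter l dx eta z|%:E < +oo)%E.
  have [M M0 bM] := iter_dx_bounded l.
  pose K : set (R * R) := `[0, 1] `*` `[-1, 1].
  have mK : measurable K by apply: measurableX.
  apply: (@le_lt_trans _ _ (\int[lambda2]_(z in K) cst M%:E z)%E).
    rewrite integral_mkcond [leRHS]integral_mkcond.
    apply: ge0_le_integral => //.
    - by move=> z _; rewrite patchE; case: ifPn => // _; rewrite lee_fin.
    - exact/(measurable_restrictT _ mH).
    - by apply/(measurable_restrictT _ mK); exact: measurable_cst.
    move=> z _; rewrite !patchE; case: ifPn => [/set_mem zH|_]; last first.
      by case: ifPn => // _; rewrite lee_fin.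
    case: ifPn => [_|zK]; first by rewrite lee_fin; exact: bM.
    case: z zH zK => t x t0 zK; rewrite iter_dx_eq0 ?normr0//.
    apply: contrapT => /negP; rewrite negb_or -!leNgt => /andP[t1 x1].
    move/negP: zK; apply; apply/mem_set.
    by split; rewrite /= in_itv/= -?ler_norml// t1 andbT.
  rewrite integral_cst//= /lambda2 product_measure1E//.
  have itv (u v : R) : (@lebesgue_measure R `[u, v] < +oo)%E.
    by rewrite lebesgue_measure_itv/=; case: ifP => _; rewrite ?ltry.
  apply: lte_mul_pinfty => //; apply: lte_mul_pinfty => //; last exact: itv.
  by rewrite ge0_fin_numE//; exact: itv.
rewrite /kernel_norm /Rintegral -lee_fin fineK//.
rewrite ge0_fin_numE//; apply: integral_ge0 => z _; rewrite lee_fin//.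
Qed.

Lemma is_derive_pow (n : nat) (x : R) : is_derive x 1 (fun y : R => y ^+ n) (n%:R * x ^+ n.-1).
Proof. by split; [exact: exprn_derivable|rewrite exp_derive/= /GRing.scale/= mulr1]. Qed.

Lemma is_derive_mul (f g : R -> R) (x a b : R) :
  is_derive x 1 f a -> is_derive x 1 g b ->
  is_derive x 1 (fun y => f y * g y) (f x * b + g x * a).
Proof. by move=> df dg; exact: is_deriveM. Qed.

Lemma kernel_norm01_ge1 : 1 <= kernel_norm eta 0 1.
Proof.
apply: (@kernel_norm_ge 1 1 id (fun t x => x * eta (t, x))) => //.
- by move=> x; exact: cvg_id.
- move=> t x t0.
  apply: is_derive_eq (is_derive_mul (is_derive_id x 1) (is_derive_iter_dx 0 x t0)) _.
  by rewrite mulr1 mul1r addrC.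
- move=> t t0; have /= -> := @iter_dx_eq0 0 t 2 t0; first by rewrite mulr0.
  by rewrite ger0_norm// ltr1n orbT.
- move=> t t0; have /= -> := @iter_dx_eq0 0 t (-2) t0; first by rewrite mulr0.
  by rewrite normrN ger0_norm// ltr1n orbT.
Qed.

Lemma kernel_norm03_ge6 : 6 <= kernel_norm eta 0 3.
Proof.
(* Three integrations by parts of x^3 d_x^3 eta: in the derivative all terms cancel except this one
   and 6 eta. *)
apply: (@kernel_norm_ge 3 6 (fun x => x ^+ 3) (fun t x => x ^+ 3 * iter 2 dx eta (t, x)
   - 3 * x ^+ 2 * iter 1 dx eta (t, x) + 6 * x * eta (t, x))) => //.
- by move=> x; exact: exprn_continuous.
- by move=> x x1; rewrite normrX exprn_ile1.
- move=> t x t0.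
  have d2 := is_derive_mul (is_derive_pow 3 x) (is_derive_iter_dx 2 x t0).
  have d1 := is_derive_mul (is_deriveZ 3 (is_derive_pow 2 x)) (is_derive_iter_dx 1 x t0).
  have d0 := is_derive_mul (is_deriveZ 6 (is_derive_id x 1)) (is_derive_iter_dx 0 x t0).
  apply: is_derive_eq (is_deriveD (is_deriveB d2 d1) d0) _.
  rewrite /GRing.scale [iter 0 _ _]/=.
  move: (iter 1 dx eta _) (iter 2 dx eta _) (iter 3 dx eta _) (eta _) => g1 g2 g3 g0.
  by rewrite /= /GRing.scale/=; ring.
- move=> t t0; have h k := @iter_dx_eq0 k t 2 t0.
  have tt : (1 < t) || (1 < `|2 : R|) by rewrite ger0_norm// ltr1n orbT.
  have /= h0 := h 0%N tt; have /= h1 := h 1%N tt; have /= h2 := h 2%N tt.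
  by rewrite /= h2 h1 h0 !mulr0 subrr addr0.
- move=> t t0; have h k := @iter_dx_eq0 k t (-2) t0.
  have tt : (1 < t) || (1 < `|- 2 : R|) by rewrite normrN ger0_norm// ltr1n orbT.
  have /= h0 := h 0%N tt; have /= h1 := h 1%N tt; have /= h2 := h 2%N tt.
  by rewrite /= h2 h1 h0 !mulr0 subrr addr0.
Qed.

End KernelBounds.

(** * One-step operators *)

Section ConvexStep.
Context {R : realType}.

(** The law of xi_1: D will be the set of phi with phi(xi_1) in H, and L phi the expectation of
    phi(xi_1). The analysis of one step then concerns functions of a real variable only. *)
Record convex_law (D : set (R -> R)) (L : (R -> R) -> R) : Prop := {
  cl_cst : forall c, D (fun=> c);
  cl_lin : forall c X Y, D X -> D Y -> D (fun y => c * X y + Y y);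
  cl_Cb : forall g, Cb _ g -> D g;
  cl_D1 : D (fun y => y);
  cl_D2 : D (fun y => y ^+ 2);
  cl_D3 : D (fun y => y ^+ 3);
  cl_D4 : D (fun y => y ^+ 4);
  cl_mono : forall X Y, D X -> D Y -> (forall y, X y <= Y y) -> L X <= L Y;
  cl_convex : forall l X Y, 0 <= l <= 1 -> D X -> D Y ->
    L (fun y => l * X y + (1 - l) * Y y) <= l * L X + (1 - l) * L Y;
  cl_Lcst : forall c, L (fun=> c) = c;
  cl_L1 : forall b, L (fun y => b * y) = 0;
  cl_L3 : forall c, L (fun y => c * y ^+ 3) = 0
}.

Variables (D : set (R -> R)) (L : (R -> R) -> R).
Hypothesis cl : convex_law D L.
Implicit Types (X Y Z g : R -> R) (r s t c d k x y M : R).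

Lemma law_add X Y : D X -> D Y -> D (fun y => X y + Y y).
Proof.
move=> dX dY; have := cl_lin cl 1 dX dY.
by congr D; apply/funext => y; rewrite mul1r.
Qed.

Lemma law_scale c X : D X -> D (fun y => c * X y).
Proof.
move=> dX; have := cl_lin cl c dX (cl_cst cl 0).
by congr D; apply/funext => y; rewrite addr0.
Qed.

(* Splitting X + Z as (1 - s) X + s (X + Z / s) and letting s tend to 0 *)
Lemma law_add_linear X Z z : D X -> D Z -> (forall m, L (fun y => m * Z y) = m * z) ->
  L (fun y => X y + Z y) = L X + z.
Proof.
have le (X' Z' : R -> R) z' : D X' -> D Z' -> (forall m, L (fun y => m * Z' y) = m * z') ->
    L (fun y => X' y + Z' y) <= L X' + z'.
  move=> dX dZ LZ; set K := 2^-1 * L (fun y => 2 * X' y) - L X'.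
  apply: (@ler_invS_limit _ _ _ K) => N; set s : R := N.+1%:R^-1.
  have s0 : 0 < s by rewrite invr_gt0 ltr0n.
  have s1 : s <= 1 by rewrite invf_le1 ?ler1n ?ltr0n.
  have d2 : D (fun y => 2 * X' y) by exact: law_scale.
  have d3 : D (fun y => 2 / s * Z' y) by exact: law_scale.
  (* [V] is X' + Z' / s. A second convex split bounds L V by a constant plus z' / s, and the factor
     s in front leaves z' in the limit. *)
  pose V y := 2^-1 * (2 * X' y) + (1 - 2^-1) * (2 / s * Z' y).
  have dV : D V by apply: law_add; apply: law_scale.
  have -> : (fun y => X' y + Z' y) = (fun y => s * V y + (1 - s) * X' y).
    by apply/funext => y; rewrite /V; field; rewrite gt_eqF.
  apply: le_trans (cl_convex cl _ dV dX) _; first by rewrite ltW.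
  have : L V <= 2^-1 * L (fun y => 2 * X' y) + (1 - 2^-1) * (2 / s * z').
    rewrite -LZ; apply: (cl_convex cl) => //; lra.
  rewrite -(ler_pM2l s0) => h.
  have e : s * ((1 - 2^-1) * (2 / s * z')) = z' by field; rewrite gt_eqF.
  rewrite mulrDr e in h; rewrite /K -/s; nra.
move=> dX dZ LZ; apply/eqP; rewrite eq_le le//=.
have dN : D (fun y => - Z y).
  have := law_scale (-1) dZ; congr D; apply/funext => y; exact: mulN1r.
have := le _ (fun y => - Z y) (- z) (law_add dX dZ) dN.
rewrite (_ : (fun y => X y + Z y + - Z y) = X); last by apply/funext => y; rewrite addrK.
have h m : L (fun y => m * - Z y) = m * - z.
  by rewrite mulrN -mulNr -LZ; congr L; apply/funext => y; ring.
by move/(_ h); lra.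
Qed.

Lemma law_addc X c : D X -> L (fun y => X y + c) = L X + c.
Proof.
move=> dX; apply: (law_add_linear dX (cl_cst cl c)) => m; exact: (cl_Lcst cl).
Qed.

Lemma law_add_odd X b c : D X -> L (fun y => X y + (b * y + c * y ^+ 3)) = L X.
Proof.
move=> dX.
have d1 : D (fun y => b * y) by apply: law_scale; exact: (cl_D1 cl).
have d3 : D (fun y => c * y ^+ 3) by apply: law_scale; exact: (cl_D3 cl).
have -> : (fun y => X y + (b * y + c * y ^+ 3)) = (fun y => (X y + b * y) + c * y ^+ 3).
  by apply/funext => y; rewrite addrA.
rewrite (@law_add_linear _ _ 0 (law_add dX d1) d3); last first.
  move=> m; rewrite mulr0 -(cl_L3 cl (m * c)).
  by congr L; apply/funext => y; ring.
rewrite (@law_add_linear _ _ 0 dX d1) ?addr0// => m.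
rewrite mulr0 -(cl_L1 cl (m * b)).
by congr L; apply/funext => y; ring.
Qed.

Lemma law_opp X : D X -> - L (fun y => - X y) <= L X.
Proof.
move=> dX.
have dN : D (fun y => - X y).
  have := law_scale (-1) dX; congr D; apply/funext => y; exact: mulN1r.
have h2 : 0 <= (2^-1 : R) <= 1 by lra.
have := cl_convex cl h2 dX dN.
rewrite (_ : (fun y => 2^-1 * X y + (1 - 2^-1) * - X y) = fun=> 0); last first.
  by apply/funext => y; field.
by rewrite (cl_Lcst cl); lra.
Qed.

(** L is not homogeneous, so the coefficient stays inside; as a function of c such a moment is
    convex and vanishes at 0. *)
Definition mom2 c := L (fun y => c * y ^+ 2).
Definition mom4 c := L (fun y => c * y ^+ 4).

Lemma mom4_D c : D (fun y => c * y ^+ 4).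
Proof. by apply: law_scale; exact: (cl_D4 cl). Qed.

Lemma mom2_D c : D (fun y => c * y ^+ 2).
Proof. by apply: law_scale; exact: (cl_D2 cl). Qed.

Lemma mom4_le c c' : c <= c' -> mom4 c <= mom4 c'.
Proof.
move=> cc; apply: (cl_mono cl (mom4_D c) (mom4_D c')) => y.
by apply: ler_wpM2r => //; exact: exprn_even_ge0.
Qed.

Lemma mom4_ge0 c : 0 <= c -> 0 <= mom4 c.
Proof.
move=> c0; rewrite -(cl_Lcst cl 0); apply: (cl_mono cl (cl_cst cl 0) (mom4_D c)) => y.
by rewrite mulr_ge0// exprn_even_ge0.
Qed.

(** A convex function vanishing at 0 is superadditive on the half-line, since it lies below its
    chord from 0 to c + k. *)
Lemma mom4_sub c k : 0 <= c -> 0 <= k -> mom4 c + mom4 k <= mom4 (c + k).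
Proof.
move=> c0 k0.
have [/eqP ck|ck] := boolP (c + k == 0).
  have -> : c = 0 by lra.
  have -> : k = 0 by lra.
  rewrite addr0 (_ : mom4 0 = 0) ?addr0//.
  by rewrite /mom4 -[RHS](cl_Lcst cl 0); congr L; apply/funext => y; rewrite mul0r.
have ck0 : 0 < c + k by rewrite lt_neqAle eq_sym ck addr_ge0.
have h (u : R) : 0 <= u <= c + k -> mom4 u <= u / (c + k) * mom4 (c + k).
  move=> /andP[u0 uk].
  have l : 0 <= u / (c + k) <= 1 by rewrite divr_ge0 ?(ltW ck0)//= ler_pdivrMr// mul1r.
  have := cl_convex cl l (mom4_D (c + k)) (cl_cst cl 0).
  rewrite (cl_Lcst cl) mulr0 addr0 -/(mom4 _); congr (_ <= _).
  by congr L; apply/funext => y; field.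
have h1 := h c; have h2 := h k.
have e : c / (c + k) * mom4 (c + k) + k / (c + k) * mom4 (c + k) = mom4 (c + k).
  by field.
rewrite -[leRHS]e; apply: lerD; [apply: h1|apply: h2]; apply/andP; split; lra.
Qed.

(** * The one-step operator with a quartic perturbation *)

(** For c = 0 this is I(t). The term c y^4 makes room for a Taylor remainder inside L, from where a
    merely convex L does not let it be split off. *)
Definition step t c g x := t * L (fun y => t^-1 * g (x + Num.sqrt t * y) + c * y ^+ 4).

Lemma lipb_comp_D r g x s : lipb r g -> D (fun y => g (x + s * y)).
Proof.
move=> gr; apply: (cl_Cb cl); split.
  move=> y; apply: (@continuous_comp _ _ _ (fun y => x + s * y) g).
    apply: cvgD; first exact: cvg_cst.
    by apply: cvgM; [exact: cvg_cst|exact: cvg_id].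
  exact: lipb_continuous gr _.
have [_ [M gM]] := gr; exists M; split; first exact: num_real.
by move=> m Mm y _; apply: le_trans (gM _) (ltW Mm).
Qed.

Lemma step_D r t c g x : lipb r g ->
  D (fun y => t^-1 * g (x + Num.sqrt t * y) + c * y ^+ 4).
Proof.
move=> gr; apply: law_add (mom4_D c); apply: law_scale; exact: lipb_comp_D gr.
Qed.

Lemma step_le r r' t c g1 g2 k : 0 < t -> lipb r g1 -> lipb r' g2 ->
  (forall x, g1 x <= g2 x + k) -> forall x, step t c g1 x <= step t c g2 x + k.
Proof.
move=> t0 h1 h2 g12 x; rewrite /step.
have -> : k = t * (t^-1 * k) by rewrite mulVKf// gt_eqF.
rewrite -mulrDr ler_pM2l// -law_addc; last exact: step_D h2.
apply: (cl_mono cl); first exact: step_D h1.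
  by apply: law_add (cl_cst cl _); exact: step_D h2.
by move=> y; rewrite addrAC lerD2r -mulrDr ler_pM2l ?invr_gt0.
Qed.

Arguments step_le {r r' t c g1 g2 k}.

Lemma step_cst t c k x : 0 < t -> step t c (fun=> k) x = k + t * mom4 c.
Proof.
move=> t0; rewrite /step.
have -> : (fun y : R => t^-1 * k + c * y ^+ 4) = (fun y => c * y ^+ 4 + t^-1 * k).
  by apply/funext => y; rewrite addrC.
by rewrite law_addc ?mulrDr ?mulVKf ?gt_eqF// 1?addrC//; exact: mom4_D.
Qed.

Lemma lipb_cst k : lipb 0 (fun=> k).
Proof. by split=> [x y|]; [rewrite subrr normr0 mul0r|exists `|k|]. Qed.

Lemma step_le_cst r t c g k x : 0 < t -> lipb r g -> (forall x, g x <= k) ->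
  step t c g x <= k + t * mom4 c.
Proof.
move=> t0 gr gk; rewrite -(step_cst _ _ x t0) -[leRHS]addr0.
by apply: step_le t0 gr (lipb_cst k) _ x => y; rewrite addr0.
Qed.

Lemma step_ge_cst r t c g k x : 0 < t -> lipb r g -> (forall x, k <= g x) ->
  k + t * mom4 c <= step t c g x.
Proof.
move=> t0 gr gk; rewrite -(step_cst _ _ x t0) -[leRHS]addr0.
by apply: step_le t0 (lipb_cst k) gr _ x => y; rewrite addr0.
Qed.

Arguments step_le_cst {r t c g k x}.
Arguments step_ge_cst {r t c g k x}.

Lemma lipb_shift r g z : lipb r g -> lipb r (fun x => g (x + z)).
Proof.
move=> [gl [M gM]]; split; last by exists M.
by move=> x y; apply: le_trans (gl _ _) _; rewrite (_ : x + z - _ = x - y)//; ring.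
Qed.

Lemma step_shift t c g z x : step t c (fun x => g (x + z)) x = step t c g (x + z).
Proof. by rewrite /step; congr (t * L _); apply/funext => y; rewrite addrAC. Qed.

(** The step commutes with translations and is monotone up to constants, so the Lipschitz constant
    survives; only the sup bound may grow. *)
Lemma step_lipb r t c g : 0 < t -> lipb r g -> lipb r (step t c g).
Proof.
move=> t0 gr; split.
  suff h x y : step t c g x <= step t c g y + r * `|x - y|.
    move=> x y; rewrite ler_norml lerNl opprB !lerBlDl h andbT distrC; exact: h.
  have -> : step t c g x = step t c (fun u => g (u + (x - y))) y.
    by rewrite step_shift addrC subrK.
  apply: (step_le t0 (lipb_shift (x - y) gr) gr) => z.
  rewrite -lerBlDl; apply: le_trans (ler_norm _) _.
  by apply: le_trans (lipb_dist gr _ _) _; rewrite addrAC subrr add0r.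
have [_ [M gM]] := gr; exists (M + `|t * mom4 c|) => x.
rewrite ler_norml; apply/andP; split.
  have : - M + t * mom4 c <= step t c g x.
    by apply: step_ge_cst t0 gr _ => y; have := gM y; rewrite ler_norml => /andP[].
  by have := ler_norm (- (t * mom4 c)); rewrite normrN; lra.
have : step t c g x <= M + t * mom4 c.
  by apply: step_le_cst t0 gr _ => y; have := gM y; rewrite ler_norml => /andP[].
by have := ler_norm (t * mom4 c); lra.
Qed.

Lemma iter_step_lipb r t c g m : 0 < t -> lipb r g -> lipb r (iter m (step t c) g).
Proof. by move=> t0 gr; elim: m => //= m; exact: step_lipb. Qed.

Lemma lipb_conv r s g1 g2 : 0 <= s <= 1 -> lipb r g1 -> lipb r g2 ->
  lipb r (fun x => s * g1 x + (1 - s) * g2 x).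
Proof.
move=> /andP[s0 s1] [l1 [M1 b1]] [l2 [M2 b2]]; have s1' : 0 <= 1 - s by lra.
have tri (u v : R) : `|s * u + (1 - s) * v| <= s * `|u| + (1 - s) * `|v|.
  by apply: le_trans (ler_normD _ _) _; rewrite !normrM (ger0_norm s0) (ger0_norm s1').
split.
  move=> x y.
  have -> : s * g1 x + (1 - s) * g2 x - (s * g1 y + (1 - s) * g2 y) =
    s * (g1 x - g1 y) + (1 - s) * (g2 x - g2 y) by ring.
  apply: le_trans (tri _ _) _.
  have -> : r * `|x - y| = s * (r * `|x - y|) + (1 - s) * (r * `|x - y|) by ring.
  by apply: lerD; apply: ler_wpM2l.
exists (s * M1 + (1 - s) * M2) => x; apply: le_trans (tri _ _) _.
by apply: lerD; apply: ler_wpM2l.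
Qed.

(** Convexity is joint in the quartic coefficient and the function, so two evolutions with
    coefficients of opposite sign can be mixed to dominate an unperturbed one. *)
Lemma step_convex r t c1 c2 s g1 g2 x : 0 < t -> 0 <= s <= 1 -> lipb r g1 -> lipb r g2 ->
  step t (s * c1 + (1 - s) * c2) (fun x => s * g1 x + (1 - s) * g2 x) x <=
  s * step t c1 g1 x + (1 - s) * step t c2 g2 x.
Proof.
move=> t0 s01 h1 h2; rewrite /step.
set X1 := (X in _ * (_ * L X) + _); set X2 := (X in _ + _ * (_ * L X)).
have -> : s * (t * L X1) + (1 - s) * (t * L X2) = t * (s * L X1 + (1 - s) * L X2) by ring.
rewrite ler_pM2l//.
apply: le_trans (cl_convex cl s01 (step_D t c1 x h1) (step_D t c2 x h2)).
by rewrite le_eqVlt; apply/orP; left; apply/eqP; congr L; apply/funext => y; ring.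
Qed.

(** * Finite means and Jensen's inequality *)

Definition mean m (G : nat -> R -> R) x := m.+1%:R^-1 * \sum_(i < m.+1) G i x.

(** Means arise from successive convex combinations of two functions, so whatever is stable under
    these extends to means by induction. *)
Lemma meanS m G : mean m.+1 G =
  (fun x => (1 - m.+2%:R^-1) * mean m G x + (1 - (1 - m.+2%:R^-1)) * G m.+1 x).
Proof.
apply/funext => x; rewrite /mean big_ord_recr/= mulrDr; congr (_ + _); last first.
  by congr (_ * _); ring.
rewrite mulrA; congr (_ * _).
rewrite -[m.+2%:R]natr1; set u : R := m.+1%:R; have : 0 < u by rewrite ltr0n.
by move=> u0; field; rewrite !gt_eqF//; lra.
Qed.

Lemma mean_weight m : 0 <= 1 - (m.+2%:R : R)^-1 <= 1.
Proof.
have h : (m.+2%:R : R)^-1 <= 1 by rewrite invf_le1 ?ler1n ?ltr0n.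
by rewrite subr_ge0 h lerBlDr lerDl invr_ge0 ler0n.
Qed.

Lemma mean0 G : mean 0 G = G 0%N.
Proof. by apply/funext => x; rewrite /mean big_ord_recl big_ord0 addr0 invr1 mul1r. Qed.

Lemma mean_lipb r m G : (forall i, lipb r (G i)) -> lipb r (mean m G).
Proof.
move=> Gr; elim: m => [|m ih]; first by rewrite mean0.
by rewrite meanS; apply: lipb_conv => //; exact: mean_weight.
Qed.

Lemma step_mean r t m G x : 0 < t -> (forall i, lipb r (G i)) ->
  step t 0 (mean m G) x <= mean m (fun i => step t 0 (G i)) x.
Proof.
move=> t0 Gr; elim: m => [|m ih]; first by rewrite !mean0.
rewrite !meanS; have s01 := mean_weight m.
have := step_convex 0 0 x t0 s01 (mean_lipb m Gr) (Gr m.+1).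
rewrite !mulr0 addr0 => /le_trans; apply; rewrite lerD2r ler_wpM2l//.
by case/andP: s01.
Qed.

Lemma mean_le m G1 G2 x k : (forall i, (i <= m)%N -> G1 i x <= G2 i x + k) ->
  mean m G1 x <= mean m G2 x + k.
Proof.
move=> h; rewrite /mean -lerBlDl -mulrBr -sumrB mulrC ler_pdivrMr ?ltr0n//.
have -> : k * m.+1%:R = \sum_(i < m.+1) k by rewrite sumr_const card_ord -[RHS]mulr_natr.
by apply: ler_sum => i _; rewrite lerBlDl h// -ltnS.
Qed.

(** Jensen's inequality, obtained from finite means of translates, with which the step commutes; the
    two Riemann sum errors vanish as N grows. *)
Lemma step_stek r d t g x : 0 < d -> 0 < t -> lipb r g ->
  step t 0 (stek d g) x <= stek d (step t 0 g) x.
Proof.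
move=> d0 t0 gr; apply: (@ler_invS_limit _ _ _ (2 * d * r + 2 * d * r)) => N.
have sr : lipb r (step t 0 g) by exact: step_lipb.
pose e : R := 2 * d * r / N.+1%:R.
pose z (i : nat) : R := - d + 2 * d * i%:R / N.+1%:R.
pose G i x := g (x + z i).
have Gr i : lipb r (G i) by exact: lipb_shift.
have nodeE i u : node d N i u = u + z i by rewrite /node /z addrA.
have hm (f : R -> R) u : N.+1%:R^-1 * \sum_(i < N.+1) f (node d N i u) =
    mean N (fun i u => f (u + z i)) u.
  by rewrite /mean; congr (_ * _); apply: eq_bigr => i _; rewrite nodeE.
have h1 : step t 0 (stek d g) x <= step t 0 (mean N G) x + e.
  apply: step_le t0 (stek_lipb d0 gr) (mean_lipb N Gr) _ x => u.
  have := stek_avg N u d0 gr; rewrite hm -/G -/e ler_norml => /andP[_].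
  by rewrite lerBlDl addrC.
have h2 := step_mean N x t0 Gr.
have h3 : mean N (fun i => step t 0 (G i)) x <= stek d (step t 0 g) x + e.
  have := stek_avg N x d0 sr; rewrite hm -/e ler_norml => /andP[+ _].
  have -> : mean N (fun i => step t 0 (G i)) x = mean N (fun i u => step t 0 g (u + z i)) x.
    by rewrite /mean; congr (_ * _); apply: eq_bigr => i _; rewrite step_shift.
  by rewrite lerBrDl; lra.
by rewrite mulrDl -/e; lra.
Qed.

Lemma step_smooth r d t g x : 0 < d -> 0 < t -> lipb r g ->
  step t 0 (smooth d g) x <= smooth d (step t 0 g) x.
Proof.
move=> d0 t0 gr.
have g1 := stek_lipb d0 gr; have g2 := stek_lipb d0 g1.
have s0 := step_lipb 0 t0 gr; have s1 := step_lipb 0 t0 g1; have s2 := step_lipb 0 t0 g2.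
have e1 := stek_lipb d0 s0.
apply: le_trans (step_stek x d0 t0 g2) _; rewrite -[leRHS]addr0.
apply: (stek_le d0 s2 (stek_lipb d0 e1)) => u; rewrite addr0.
apply: le_trans (step_stek u d0 t0 g1) _; rewrite -[leRHS]addr0.
by apply: (stek_le d0 s1 e1) => v; rewrite addr0; exact: step_stek d0 t0 gr.
Qed.

(** * Quadratic barriers and regularity in time *)

(** Expanding the square leaves a linear term, which L does not see, and B y^2 with factor t^(-1)
    (sqrt t)^2 = 1. The sign of B is free, so that upper and lower barriers are both covered. *)
Lemma step_quad t B k z x : 0 < t ->
  D (fun y => t^-1 * (k + B * (x + Num.sqrt t * y - z) ^+ 2)) /\
  t * L (fun y => t^-1 * (k + B * (x + Num.sqrt t * y - z) ^+ 2)) =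
    k + t * mom2 B + B * (x - z) ^+ 2.
Proof.
move=> t0; pose s := Num.sqrt t.
have ss : s * s = t by rewrite -expr2 sqr_sqrtr// ltW.
pose b := t^-1 * (2 * B * (x - z) * s); pose K := t^-1 * (k + B * (x - z) ^+ 2).
have dK : D (fun y => B * y ^+ 2 + K) by apply: law_add (mom2_D B) (cl_cst cl K).
have -> : (fun y => t^-1 * (k + B * (x + Num.sqrt t * y - z) ^+ 2)) =
    (fun y => B * y ^+ 2 + K + (b * y + 0 * y ^+ 3)).
  apply/funext => y; rewrite mul0r addr0 -/s.
  have -> : B * (x + s * y - z) ^+ 2 =
      B * (x - z) ^+ 2 + 2 * B * (x - z) * s * y + (s * s) * (B * y ^+ 2) by ring.
  by rewrite ss /K /b; field; rewrite gt_eqF.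
split.
  apply: (law_add dK); apply: law_add; apply: law_scale; first exact: (cl_D1 cl).
  exact: (cl_D3 cl).
rewrite law_add_odd// law_addc; last exact: mom2_D.
by rewrite mulrDr /K mulVKf ?gt_eqF// /mom2; ring.
Qed.

Lemma step_quad_le r t B k g z : 0 < t -> lipb r g ->
  (forall x, g x <= k + B * (x - z) ^+ 2) ->
  forall x, step t 0 g x <= k + t * mom2 B + B * (x - z) ^+ 2.
Proof.
move=> t0 gr gB x; have [dq <-] := step_quad B k z x t0.
rewrite ler_pM2l//; apply: (cl_mono cl (step_D t 0 x gr) dq) => y.
by rewrite mul0r addr0 ler_pM2l ?invr_gt0.
Qed.

Lemma step_quad_ge r t B k g z : 0 < t -> lipb r g ->
  (forall x, k + B * (x - z) ^+ 2 <= g x) ->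
  forall x, k + t * mom2 B + B * (x - z) ^+ 2 <= step t 0 g x.
Proof.
move=> t0 gr gB x; have [dq <-] := step_quad B k z x t0.
rewrite ler_pM2l//; apply: (cl_mono cl dq (step_D t 0 x gr)) => y.
by rewrite mul0r addr0 ler_pM2l ?invr_gt0.
Qed.

Lemma mom2_opp B : - mom2 B <= mom2 (- B).
Proof.
have := law_opp (mom2_D (- B)); congr (- _ <= _).
by congr L; apply/funext => y; rewrite mulNr opprK.
Qed.

(* r |x - z| <= r^2 / (4 B) + B (x - z)^2, and parabolas are mapped to parabolas
   by the one-step operator. *)
Lemma iter_step_dist r t g m B x : 0 < t -> 0 < B -> lipb r g ->
  `|iter m (step t 0) g x - g x| <= r ^+ 2 / (4 * B) + m%:R * t * mom2 B.
Proof.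
move=> t0 B0 gr; set e := r ^+ 2 / (4 * B).
have amgm z : r * `|z - x| <= e + B * (z - x) ^+ 2.
  rewrite -(real_normK (num_real (z - x))); move: `|z - x| => w.
  rewrite -subr_ge0 (_ : _ - _ = B * (w - r / (2 * B)) ^+ 2).
    by rewrite mulr_ge0 ?(ltW B0)// sqr_ge0.
  by rewrite /e; field; rewrite gt_eqF.
have up z : g z <= g x + e + B * (z - x) ^+ 2.
  have := lipb_dist gr z x; rewrite ler_norml => /andP[_]; have := amgm z; lra.
have lo z : g x - e + (- B) * (z - x) ^+ 2 <= g z.
  have := lipb_dist gr z x; rewrite ler_norml => /andP[+ _]; have := amgm z; lra.
have iu n z : iter n (step t 0) g z <= g x + e + n%:R * t * mom2 B + B * (z - x) ^+ 2.
  elim: n z => [|n ih] z; first by rewrite !mul0r addr0.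
  have := step_quad_le t0 (iter_step_lipb 0 n t0 gr) ih z.
  by rewrite iterS -natr1; lra.
have il n z : g x - e + n%:R * t * mom2 (- B) + (- B) * (z - x) ^+ 2 <= iter n (step t 0) g z.
  elim: n z => [|n ih] z; first by rewrite !mul0r addr0.
  have := step_quad_ge t0 (iter_step_lipb 0 n t0 gr) ih z.
  by rewrite iterS -natr1; lra.
have := iu m x; have := il m x; rewrite subrr expr0n/= !mulr0 !addr0 => h1 h2.
have : m%:R * t * (- mom2 B) <= m%:R * t * mom2 (- B).
  by apply: ler_wpM2l (mom2_opp B); rewrite mulr_ge0 ?ler0n// ltW.
by rewrite mulrN ler_norml => h3; apply/andP; split; lra.
Qed.

(** * Taylor expansion at two step sizes *)

(** The coefficients stay existential: those of order 1 and 3 are invisible to L, and that of order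
    2 cancels between two step sizes. In this form the property is stable under convex
    combinations. *)
Definition taylor4 C g x := exists c1 c2 c3, forall y,
  `|g (x + y) - g x - (c1 * y + c2 * y ^+ 2 + c3 * y ^+ 3)| <= C * y ^+ 4.

Lemma taylor4_conv C s g1 g2 x : 0 <= s <= 1 -> taylor4 C g1 x -> taylor4 C g2 x ->
  taylor4 C (fun x => s * g1 x + (1 - s) * g2 x) x.
Proof.
move=> /andP[s0 s1] [a1 [a2 [a3 ha]]] [b1 [b2 [b3 hb]]].
have s1' : 0 <= 1 - s by lra.
exists (s * a1 + (1 - s) * b1), (s * a2 + (1 - s) * b2), (s * a3 + (1 - s) * b3) => y.
set u := g1 (x + y) - g1 x - (a1 * y + a2 * y ^+ 2 + a3 * y ^+ 3) in ha *.
set v := g2 (x + y) - g2 x - (b1 * y + b2 * y ^+ 2 + b3 * y ^+ 3) in hb *.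
rewrite (_ : _ - _ = s * (g1 (x + y) - g1 x - (a1 * y + a2 * y ^+ 2 + a3 * y ^+ 3)) +
  (1 - s) * (g2 (x + y) - g2 x - (b1 * y + b2 * y ^+ 2 + b3 * y ^+ 3))); last by ring.
apply: le_trans (ler_normD _ _) _; rewrite !normrM (ger0_norm s0) (ger0_norm s1').
have -> : C * y ^+ 4 = s * (C * y ^+ 4) + (1 - s) * (C * y ^+ 4) by ring.
by apply: lerD; apply: ler_wpM2l.
Qed.

Lemma taylor4_mean C m G x : (forall i, taylor4 C (G i) x) -> taylor4 C (mean m G) x.
Proof.
move=> h; elim: m => [|m ih]; first by rewrite mean0.
by rewrite meanS; apply: taylor4_conv => //; exact: mean_weight.
Qed.

Lemma step_quotient r t c g x : 0 < t -> lipb r g ->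
  t^-1 * (step t c g x - g x) =
  L (fun y => t^-1 * (g (x + Num.sqrt t * y) - g x) + c * y ^+ 4).
Proof.
move=> t0 gr; rewrite mulrBr /step mulKf ?gt_eqF// -law_addc; last exact: step_D gr.
by congr L; apply/funext => y; ring.
Qed.

(* The increments of g at the two scales differ by an odd cubic polynomial, which
   L does not see, and by a quartic remainder. *)
Lemma step_taylor_le r C t1 t2 g x : 0 < t1 -> 0 < t2 -> lipb r g -> taylor4 C g x ->
  t2^-1 * (step t2 (- ((t1 + t2) * C)) g x - g x) <= t1^-1 * (step t1 0 g x - g x).
Proof.
move=> t10 t20 gr [c1 [c2 [c3 h]]]; rewrite !(step_quotient _ _ _ gr)//.
have qD t c : D (fun y => t^-1 * (g (x + Num.sqrt t * y) - g x) + c * y ^+ 4).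
  apply: law_add (mom4_D c); apply: law_scale.
  exact: (law_add (lipb_comp_D x (Num.sqrt t) gr) (cl_cst cl (- g x))).
have root t : 0 < t -> exists2 s, 0 < s & t = s ^+ 2 /\ Num.sqrt t = s.
  by move=> t0; exists (Num.sqrt t); rewrite ?sqrtr_gt0// sqr_sqrtr// ltW.
have [s1 s10 [e1 q1]] := root _ t10; have [s2 s20 [e2 q2]] := root _ t20.
(* With s_i = sqrt t_i, the quotients contain c1 y / s_i and c3 s_i y^3; b and c are the differences
   of these coefficients. *)
pose b := c1 * (s2^-1 - s1^-1); pose c := c3 * (s2 - s1).
rewrite -(law_add_odd b c (qD t1 0)); apply: (cl_mono cl) => //.
  apply: law_add (qD _ _) _; apply: law_add; apply: law_scale; first exact: (cl_D1 cl).
  exact: (cl_D3 cl).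
move=> y; rewrite q1 q2 mul0r addr0.
have := h (s1 * y); have := h (s2 * y).
set u2 := g (x + s2 * y) - g x; set u1 := g (x + s1 * y) - g x.
rewrite !ler_norml => /andP[_ h2] /andP[h1 _].
have k2 : t2^-1 * u2 <= c1 * s2^-1 * y + c2 * y ^+ 2 + c3 * s2 * y ^+ 3 + t2 * C * y ^+ 4.
  rewrite mulrC ler_pdivrMr// e2.
  have -> : (c1 * s2^-1 * y + c2 * y ^+ 2 + c3 * s2 * y ^+ 3 + s2 ^+ 2 * C * y ^+ 4) * s2 ^+ 2 =
    c1 * (s2 * y) + c2 * (s2 * y) ^+ 2 + c3 * (s2 * y) ^+ 3 + C * (s2 * y) ^+ 4.
    by field; rewrite gt_eqF.
  lra.
have k1 : c1 * s1^-1 * y + c2 * y ^+ 2 + c3 * s1 * y ^+ 3 - t1 * C * y ^+ 4 <= t1^-1 * u1.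
  rewrite [leRHS]mulrC ler_pdivlMr// e1.
  have -> : (c1 * s1^-1 * y + c2 * y ^+ 2 + c3 * s1 * y ^+ 3 - s1 ^+ 2 * C * y ^+ 4) * s1 ^+ 2 =
    c1 * (s1 * y) + c2 * (s1 * y) ^+ 2 + c3 * (s1 * y) ^+ 3 - C * (s1 * y) ^+ 4.
    by field; rewrite gt_eqF.
  lra.
rewrite /b /c; lra.
Qed.

(** * Removal of the quartic perturbation *)

Lemma iter_step_le_cst r t c g k m x : 0 < t -> lipb r g -> (forall x, g x <= k) ->
  iter m (step t c) g x <= k + m%:R * t * mom4 c.
Proof.
move=> t0 gr gk; elim: m x => [|m ih] x; first by rewrite !mul0r addr0.
have := step_le_cst (x := x) (c := c) t0 (iter_step_lipb c m t0 gr) ih.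
by rewrite iterS -natr1; lra.
Qed.

Lemma iter_step_ge_cst r t c g k m x : 0 < t -> lipb r g -> (forall x, k <= g x) ->
  k + m%:R * t * mom4 c <= iter m (step t c) g x.
Proof.
move=> t0 gr gk; elim: m x => [|m ih] x; first by rewrite !mul0r addr0.
have := step_ge_cst (x := x) (c := c) t0 (iter_step_lipb c m t0 gr) ih.
by rewrite iterS -natr1; lra.
Qed.

(* A perturbation of the quartic coefficient by -c is felt only to order s after
   all m steps: convexity is applied along the whole iteration, where the iterates
   stay bounded, and not step by step. *)
Lemma iter_step_perturb r t c s g M m x : 0 < t -> 0 < s <= 1 -> 0 <= c -> lipb r g ->
  (forall x, `|g x| <= M) ->
  iter m (step t 0) g x <= iter m (step t (- c)) g x + s * (2 * M + m%:R * t * mom4 (c / s)).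
Proof.
(* Chosen so that s c' + (1 - s) (- c) = 0, which makes the mixture unperturbed; then c' + c = c /
   s. *)
move=> t0 /andP[s0 s1] c0 gr gM; pose c' := c * (1 - s) / s.
have split z : iter m (step t 0) g z <=
    s * iter m (step t c') g z + (1 - s) * iter m (step t (- c)) g z.
  elim: m z => [|m ih] z; first by rewrite /=; lra.
  have s01 : 0 <= s <= 1 by rewrite (ltW s0).
  have l1 := iter_step_lipb c' m t0 gr; have l2 := iter_step_lipb (- c) m t0 gr.
  have := step_convex c' (- c) z t0 s01 l1 l2.
  rewrite (_ : s * c' + (1 - s) * - c = 0); last by rewrite /c'; field; rewrite gt_eqF.
  rewrite !iterS; apply: le_trans; rewrite -[leRHS]addr0.
  apply: (step_le t0 (iter_step_lipb 0 m t0 gr) (lipb_conv s01 l1 l2)) => y.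
  by rewrite addr0.
have gMu z : g z <= M by have := gM z; rewrite ler_norml => /andP[].
have gMl z : - M <= g z by have := gM z; rewrite ler_norml => /andP[].
have up := iter_step_le_cst c' m x t0 gr gMu.
have lo := iter_step_ge_cst (- c) m x t0 gr gMl.
have c'0 : 0 <= c' by rewrite /c' divr_ge0 ?(ltW s0)// mulr_ge0//; lra.
have mm : mom4 c' - mom4 (- c) <= mom4 (c / s).
  have := mom4_sub c'0 c0; rewrite (_ : c' + c = c / s); last first.
    by rewrite /c'; field; rewrite gt_eqF.
  suff : - mom4 c <= mom4 (- c) by lra.
  have := law_opp (mom4_D (- c)); congr (- _ <= _).
  by congr L; apply/funext => y; rewrite mulNr opprK.
have mt : 0 <= m%:R * t by rewrite mulr_ge0 ?ler0n// ltW.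
have {mm} := ler_wpM2l mt mm; rewrite mulrBr => mm.
apply: le_trans (split x) _.
set a := iter m (step t c') g x in up *; set b := iter m (step t (- c)) g x in lo *.
have : s * (a - b) <= s * (2 * M + m%:R * t * mom4 (c / s)).
  by apply: ler_wpM2l; [exact: ltW|lra].
rewrite mulrBr; lra.
Qed.

Lemma iter_step_le r r' t c g1 g2 k m : 0 < t -> lipb r g1 -> lipb r' g2 ->
  (forall x, g1 x <= g2 x + k) ->
  forall x, iter m (step t c) g1 x <= iter m (step t c) g2 x + k.
Proof.
move=> t0 h1 h2 g12; elim: m => [//|m ih].
exact: step_le t0 (iter_step_lipb c m t0 h1) (iter_step_lipb c m t0 h2) ih.
Qed.

(** * Averages in time and comparison of two schemes *)

Lemma mean_const m g x : mean m (fun=> g) x = g x.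
Proof. by rewrite /mean sumr_const card_ord -[X in _ * X]mulr_natl mulKf. Qed.

(** By telescoping, an increment of a mean is an increment over m + 1 steps divided by m + 1. Two
    means in a row thus bound a second difference by first differences over long windows. *)
Lemma mean_succ m (v : nat -> R -> R) i x :
  mean m (fun j => v (i.+1 + j)%N) x - mean m (fun j => v (i + j)%N) x =
  m.+1%:R^-1 * (v (i + m.+1)%N x - v i x).
Proof.
rewrite /mean -mulrBr -sumrB; congr (_ * _).
under eq_bigr do rewrite addSn -addnS.
rewrite -(big_mkord xpredT (fun j => v (i + j.+1)%N x - v (i + j)%N x)).
by rewrite (telescope_sumr (fun j => v (i + j)%N x))// addn0.
Qed.

(** Discrete Taylor formula: the errors l e with l < k add up to at most k^2 e / 2. *)
Lemma second_difference_bound (w : nat -> R) (e : R) (k i : nat) :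
  (forall i, `|w i.+2 - 2 * w i.+1 + w i| <= e) ->
  `|w (i + k)%N - w i - k%:R * (w i.+1 - w i)| <= k%:R ^+ 2 / 2 * e.
Proof.
move=> he; have e0 : 0 <= e by apply: le_trans (he 0%N).
have h1 l : `|w (i + l).+1 - w (i + l)%N - (w i.+1 - w i)| <= l%:R * e.
  elim: l => [|l ih]; first by rewrite addn0 subrr normr0 mul0r.
  rewrite addnS -natr1 mulrDl mul1r.
  have -> : w (i + l).+2 - w (i + l).+1 - (w i.+1 - w i) =
    (w (i + l).+1 - w (i + l)%N - (w i.+1 - w i)) +
    (w (i + l).+2 - 2 * w (i + l).+1 + w (i + l)%N) by ring.
  by apply: le_trans (ler_normD _ _) _; apply: lerD.
elim: k => [|k ih]; first by rewrite addn0 subrr mul0r subr0 normr0 expr0n/= !mul0r.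
rewrite addnS -natr1.
have -> : w (i + k).+1 - w i - (k%:R + 1) * (w i.+1 - w i) =
  (w (i + k)%N - w i - k%:R * (w i.+1 - w i)) +
  (w (i + k).+1 - w (i + k)%N - (w i.+1 - w i)) by ring.
apply: le_trans (ler_normD _ _) _; apply: le_trans (lerD ih (h1 k)) _.
by rewrite -subr_ge0 (_ : _ - _ = e / 2); [rewrite divr_ge0|field].
Qed.

(* u is an evolution on the grid of mesh h that satisfies the scheme of step m1 h, and
   is compared with the scheme of step m2 h; the averages in time run over J + 1 points. *)
Lemma chernoff_compare r d s h M A A2 (J k m1 m2 N : nat) (u : nat -> R -> R) x :
  0 < d -> 0 < s <= 1 -> 0 < h -> (0 < k)%N ->
  m1 = k /\ m2 = 1%N \/ m1 = 1%N /\ m2 = k ->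
  (forall i, lipb r (u i)) -> (forall x, `|u 0%N x| <= M) ->
  (forall i x, step (m1%:R * h) 0 (u i) x <= u (i + m1)%N x) ->
  (forall i x, `|u (i + J.+1)%N x - u i x| <= A) ->
  (forall j x, (j <= J + J)%N -> u 0%N x <= u j x + A2) ->
  (forall j x, (j <= J + J)%N -> u (N * m2 + j)%N x <= u (N * m2)%N x + A2) ->
  N%:R * (m2%:R * h) = 1 ->
  iter N (step (m2%:R * h) 0) (u 0%N) x <=
    u (N * m2)%N x + 2 * A2 + 3 * r * d + k%:R * A / (J.+1%:R ^+ 2 * h)
    + s * (2 * M + mom4 ((m1%:R + m2%:R) * h * (r / d ^+ 3 / 24) / s)).
Proof.
move=> d0 s01 h0 k0 m12 ur uM ustep uA u0A uTA Nh.
have [m10 m20] : (0 < m1)%N /\ (0 < m2)%N by case: m12 => -[-> ->].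
have r0 : 0 <= r := lipb_ge0 (ur 0%N).
set t1 := m1%:R * h in ustep *; set t2 := m2%:R * h in Nh *.
have t10 : 0 < t1 by rewrite mulr_gt0// ltr0n.
have t20 : 0 < t2 by rewrite mulr_gt0// ltr0n.
(* [v] is mollified in space, [V] and [W] are in addition averaged in time once and twice. Jensen
   keeps all three supersolutions of the scheme of step t1. *)
pose v i := smooth d (u i).
pose V i := mean J (fun j => v (i + j)%N).
pose W i := mean J (fun j => V (i + j)%N).
have vr i : lipb r (v i) by exact: smooth_lipb.
have Vr i : lipb r (V i) by apply: mean_lipb.
have Wr i : lipb r (W i) by apply: mean_lipb.
have vstep i y : step t1 0 (v i) y <= v (i + m1)%N y.
  apply: le_trans (step_smooth y d0 t10 (ur i)) _; rewrite -[leRHS]addr0.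
  by apply: (smooth_le d0 (step_lipb 0 t10 (ur i)) (ur _)) => z; rewrite addr0.
have Vstep i y : step t1 0 (V i) y <= V (i + m1)%N y.
  apply: le_trans (step_mean J y t10 (fun j => vr (i + j)%N)) _; rewrite -[leRHS]addr0.
  by apply: mean_le => j _; rewrite addr0 addnAC; exact: vstep.
have Wstep i y : step t1 0 (W i) y <= W (i + m1)%N y.
  apply: le_trans (step_mean J y t10 (fun j => Vr (i + j)%N)) _; rewrite -[leRHS]addr0.
  by apply: mean_le => j _; rewrite addr0 addnAC; exact: Vstep.
have vA i y : `|v (i + J.+1)%N y - v i y| <= A.
  rewrite ler_norml lerNl opprB !lerBlDl ![v _ _ + A]addrC ![A + _]addrC.
  by apply/andP; split; apply: (smooth_le d0 (ur _) (ur _)) => z;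
    have := uA i z; rewrite ler_norml => /andP[]; lra.
set J1 : R := J.+1%:R; have J10 : 0 < J1 by rewrite ltr0n.
have W2 y i : `|W i.+2 y - 2 * W i.+1 y + W i y| <= 2 * A / J1 ^+ 2.
  have e1 l := mean_succ J V l y; have e2 l := mean_succ J v l y.
  have -> : W i.+2 y - 2 * W i.+1 y + W i y = (W i.+2 y - W i.+1 y) - (W i.+1 y - W i y) by ring.
  rewrite !e1 -mulrBr.
  have -> : V (i.+1 + J.+1)%N y - V i.+1 y - (V (i + J.+1)%N y - V i y) =
    (V (i + J.+1).+1 y - V (i + J.+1)%N y) - (V i.+1 y - V i y) by rewrite addSn; ring.
  rewrite !e2 -mulrBr mulrA normrM ger0_norm; last by rewrite -invfM invr_ge0 mulr_ge0// ler0n.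
  rewrite -/J1 mulrC -invfM -expr2 ler_pM2r ?invr_gt0 ?exprn_gt0//.
  apply: le_trans (ler_normB _ _) _.
  by have := vA (i + J.+1)%N y; have := vA i y; lra.
pose err := k%:R * A / (J1 ^+ 2 * h).
have kR : 0 < k%:R :> R by rewrite ltr0n.
(* One step size is h, the other k h. The bound on second differences is two-sided, which covers
   both cases of [m12]. *)
have Wk y i : t1^-1 * (W (i + m1)%N y - W i y) <= t2^-1 * (W (i + m2)%N y - W i y) + err.
  have := second_difference_bound k i (W2 y); cbv beta; rewrite ler_norml => /andP[q1 q2].
  have e3 : (k%:R * h)^-1 * (k%:R ^+ 2 / 2 * (2 * A / J1 ^+ 2)) = err.
    by rewrite /err; field; rewrite !gt_eqF.
  have e4 : h^-1 * (W i.+1 y - W i y) = (k%:R * h)^-1 * (k%:R * (W i.+1 y - W i y)).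
    by field; rewrite !gt_eqF.
  have kh : 0 < (k%:R * h)^-1 by rewrite invr_gt0 mulr_gt0.
  case: m12 => -[e5 e6]; rewrite /t1 /t2 e5 e6 mul1r addn1 e4 -e3 -mulrDr ler_pM2l//.
    by rewrite -lerBlDl.
  by move: q1; rewrite lerBrDl lerBlDr.
set C := r / d ^+ 3 / 24; pose K := (t1 + t2) * C.
have C0 : 0 <= C by rewrite !divr_ge0// exprn_ge0// ltW.
(* Here [W] becomes a supersolution of the other scheme, with quartic coefficient - K and a source
   [err] per unit of time. *)
have Wstep2 i y : step t2 (- K) (W i) y <= W (i + m2)%N y + t2 * err.
  have WT : taylor4 C (W i) y.
    apply: taylor4_mean => j; apply: taylor4_mean => l; exact: smooth_taylor d0 (ur _).
  have := step_taylor_le t10 t20 (Wr i) WT; rewrite -/K => q.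
  have q1 : t1^-1 * (step t1 0 (W i) y - W i y) <= t1^-1 * (W (i + m1)%N y - W i y).
    by rewrite ler_pM2l ?invr_gt0// lerD2r.
  have := le_trans q (le_trans q1 (Wk y i)).
  have -> : t2^-1 * (W (i + m2)%N y - W i y) + err = t2^-1 * (W (i + m2)%N y + t2 * err - W i y).
    by field; rewrite gt_eqF.
  by rewrite ler_pM2l ?invr_gt0// lerD2r.
have Witer n y : iter n (step t2 (- K)) (W 0%N) y <= W (n * m2)%N y + n%:R * t2 * err.
  elim: n y => [|n ih] y; first by rewrite mul0n !mul0r addr0.
  rewrite iterS; apply: le_trans (step_le t20 (iter_step_lipb _ n t20 (Wr 0%N)) (Wr _) ih y) _.
  have := Wstep2 (n * m2)%N y; rewrite mulSn addnC -natr1; lra.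
(* The price of passing between [u] and [W], a shift in time plus three averages in space. It is
   paid at the initial and at the final time. *)
pose e := A2 + 3 / 2 * r * d.
have u0W y : u 0%N y <= W 0%N y + e.
  rewrite -[leLHS](mean_const J (u 0%N) y); apply: mean_le => j jJ.
  rewrite -[leLHS](mean_const J (u 0%N) y); apply: mean_le => l lJ.
  have jl : (0 + j + l <= J + J)%N.
    by rewrite add0n leq_add.
  have := u0A _ y jl; have := smooth_dist d0 (ur (0 + j + l)%N) y.
  by rewrite ler_norml /v /e => /andP[+ _]; lra.
have WT y : W (N * m2)%N y <= u (N * m2)%N y + e.
  rewrite -(mean_const J (u (N * m2)%N) y); apply: mean_le => j jJ.
  rewrite -(mean_const J (u (N * m2)%N) y); apply: mean_le => l lJ.
  have jl : (j + l <= J + J)%N by rewrite leq_add.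
  have := uTA _ y jl; have := smooth_dist d0 (ur (N * m2 + j + l)%N) y.
  by rewrite addnA ler_norml /v /e => /andP[_ +]; lra.
have K0 : 0 <= K by rewrite mulr_ge0// addr_ge0// ltW.
have p1 := iter_step_perturb N x t20 s01 K0 (ur 0%N) uM.
have p2 := iter_step_le (- K) N t20 (ur 0%N) (Wr 0%N) u0W x.
have p3 := Witer N x; have p4 := WT x.
rewrite Nh !mul1r in p1 p3.
rewrite (_ : (m1%:R + m2%:R) * h = t1 + t2); last by rewrite mulrDl.
rewrite -/K -/err.
apply: le_trans p1 _; rewrite lerD2r.
rewrite /e in p2 p4; lra.
Qed.

Lemma mom4_0 : mom4 0 = 0.
Proof. by rewrite /mom4 -[RHS](cl_Lcst cl 0); congr L; apply/funext => y; rewrite mul0r. Qed.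

Lemma mom2_ge0 c : 0 <= c -> 0 <= mom2 c.
Proof.
move=> c0; rewrite -(cl_Lcst cl 0); apply: (cl_mono cl (cl_cst cl 0) (mom2_D c)) => y.
by rewrite mulr_ge0// sqr_ge0.
Qed.

Lemma iter_step_bound r t g M m x : 0 < t -> lipb r g -> (forall x, `|g x| <= M) ->
  `|iter m (step t 0) g x| <= M.
Proof.
move=> t0 gr gM; rewrite ler_norml; apply/andP; split.
  have gl y : - M <= g y by have := gM y; rewrite ler_norml => /andP[].
  by have := iter_step_ge_cst 0 m x t0 gr gl; rewrite mom4_0 mulr0 addr0.
have gu y : g y <= M by have := gM y; rewrite ler_norml => /andP[].
by have := iter_step_le_cst 0 m x t0 gr gu; rewrite mom4_0 mulr0 addr0.
Qed.

(* 8 r = 3 r (averages in space) + 2 r (averages in time) + r (second difference in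
   time) + 2 r (removal of the quartic term), at d = s = e and J + 1 = k (1 + floor (sqrt n)). *)
Lemma chernoff_rate_one_sided r Q e g (n k q m2 N : nat) x :
  1 <= r -> 0 < e < 4^-1 -> (0 < n)%N -> (0 < k)%N ->
  n%:R^-1 <= e ^+ 4 -> 0 <= Q ->
  (Num.sqrt n%:R)^-1 * mom2 (r / (4 * e)) <= e * (Q / 2) ->
  q = k /\ m2 = 1%N \/ q = 1%N /\ m2 = k -> (N * m2 = n * k)%N ->
  lipb r g -> (forall x, `|g x| <= r) ->
  iter N (step (m2%:R / (n * k)%:R) 0) g x <=
    iter ((n * k) %/ q) (step (q%:R / (n * k)%:R) 0) g x +
    (8 * r + 3 * Q + mom4 (r / 12)) * e.
Proof.
move=> r1 /andP[e0 e4] n0 k0 ne Q0 hQ qm Nm gr gM.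
have r0 : 0 < r by lra.
have [q0 m20] : (0 < q)%N /\ (0 < m2)%N by case: qm => -[-> ->].
pose sn : R := Num.sqrt n%:R.
have n0R : 0 < n%:R :> R by rewrite ltr0n.
have k0R : 0 < k%:R :> R by rewrite ltr0n.
have snn : sn ^+ 2 = n%:R by rewrite sqr_sqrtr// ltW.
have sn0 : 0 < sn by rewrite sqrtr_gt0.
(* From e < 1/4 follow n >= 256 and sqrt n >= 16, so that rounding sqrt n up costs at most the
   factor 9/8. *)
have sn16 : 16 <= sn.
  have : 256 <= sn ^+ 2.
    rewrite snn -[256]invrK -lef_pV2 ?invrK ?posrE ?invr_gt0//.
    apply: le_trans ne _.
    rewrite (_ : 256^-1 = 4^-1 ^+ 4); last by field.
    by rewrite lerXn2r// ?nnegrE ?ltW.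
  nra.
pose j0 := (Num.truncn sn).+1.
have j0l : sn <= j0%:R by apply/ltW; exact: truncnS_gt.
have j0u : j0%:R <= 9 / 8 * sn.
  have := truncn_le sn; rewrite (ltW sn0) /j0 -natr1; lra.
have j00 : 0 < j0%:R :> R by rewrite ltr0n.
pose h : R := (n * k)%:R^-1.
have hE : h = n%:R^-1 / k%:R by rewrite /h natrM invfM.
have h0 : 0 < h by rewrite /h invr_gt0 ltr0n muln_gt0 n0.
pose B := r / (4 * e).
have B0 : 0 < B by rewrite divr_gt0// mulr_gt0.
have m2B : 0 <= mom2 B by apply: mom2_ge0; exact: ltW.
have rB : r ^+ 2 / (4 * B) = r * e by rewrite /B; field; rewrite !gt_eqF.
(* This term occurs once in [A] and twice in each of two copies of [A2]: five times in all, and 5 *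
   9/16 <= 3. *)
have jQ : j0%:R / n%:R * mom2 B <= 9 / 16 * Q * e.
  have : j0%:R / n%:R <= 9 / 8 * sn^-1.
    rewrite ler_pdivrMr//; apply: le_trans j0u _.
    rewrite -[n%:R]snn (_ : 9 / 8 * sn^-1 * sn ^+ 2 = 9 / 8 * sn)//.
    by field; rewrite gt_eqF.
  move=> /(ler_wpM2r m2B) /le_trans; apply.
  have : 9 / 8 * (sn^-1 * mom2 B) <= 9 / 8 * (e * (Q / 2)) by rewrite ler_pM2l; [exact: hQ|lra].
  lra.
pose A := r * e + j0%:R / n%:R * mom2 B.
pose A2 := r * e + (2 * j0%:R) / n%:R * mom2 B.
pose t := q%:R * h; have t0 : 0 < t by rewrite mulr_gt0// ltr0n.
have qh m : (m %/ q)%:R * t <= m%:R * h.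
  rewrite /t mulrA ler_pM2r// -natrM ler_nat; exact: leq_divM.
(* Integer division places the evolution of step q h on the grid of mesh h as a piecewise constant
   sequence. *)
pose u i := iter (i %/ q) (step t 0) g.
have ur i : lipb r (u i) by exact: iter_step_lipb.
have kh m : (k * m)%:R * h = m%:R / n%:R.
  by rewrite hE natrM; field; rewrite !gt_eqF.
(* k j0 fine steps last j0 / n, about n^(-1/2), and j0 >= sqrt n brings the second difference error
   below [A]. *)
pose J := (k * j0).-1.
have JE : J.+1 = (k * j0)%N by rewrite prednK// muln_gt0 k0.
have qk : (q %| k)%N by case: qm => -[-> _]; rewrite ?dvdnn ?dvd1n.
have dist m (f : R -> R) y : lipb r f ->
    `|iter m (step t 0) f y - f y| <= r * e + m%:R * t * mom2 B.
  by move=> fr; have := iter_step_dist m y t0 B0 fr; rewrite rB.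
have uA i y : `|u (i + J.+1)%N y - u i y| <= A.
  rewrite /u JE divnDr; last by rewrite dvdn_mulr.
  rewrite addnC iterD; apply: le_trans (dist _ _ _ (ur i)) _.
  rewrite lerD2l; apply: ler_wpM2r => //.
  by apply: le_trans (qh _) _; rewrite kh.
have d2 j (f : R -> R) y : (j <= J + J)%N -> lipb r f ->
    `|iter (j %/ q) (step t 0) f y - f y| <= A2.
  move=> jJ fr; apply: le_trans (dist _ _ _ fr) _.
  rewrite lerD2l; apply: ler_wpM2r => //.
  apply: le_trans (qh _) _; rewrite -natrM -kh ler_pM2r// ler_nat mulnCA -JE.
  by apply: leq_trans jJ _; rewrite mul2n -addnn leq_add.
have sm : (m2%:R + q%:R) * h <= 2 * e ^+ 4.
  apply: (@le_trans _ _ (2 * n%:R^-1)); last by rewrite ler_pM2l.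
  rewrite hE (_ : 2 * n%:R^-1 = (2 * k%:R) * (n%:R^-1 / k%:R)); last first.
    by field; rewrite !gt_eqF.
  rewrite ler_pM2r ?divr_gt0 ?invr_gt0//.
  have : 1 <= k%:R :> R by rewrite ler1n.
  by case: qm => -[-> ->]; lra.
have e1 : 0 < e <= 1 by rewrite e0/=; lra.
have Nh : N%:R * (m2%:R * h) = 1.
  by rewrite mulrA -natrM Nm /h divff// gt_eqF// ltr0n muln_gt0 n0.
have ustep i y : step (q%:R * h) 0 (u i) y <= u (i + q)%N y.
  by rewrite /u divnDr// divnn q0 addn1.
have u0 : u 0%N = g by rewrite /u div0n.
have gM' y : `|u 0%N y| <= r by rewrite u0.
have u0A j y : (j <= J + J)%N -> u 0%N y <= u j y + A2.
  by move=> jJ; rewrite u0; have := d2 _ _ y jJ gr; rewrite ler_norml => /andP[+ _]; rewrite /u; lra.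
have Nq : (q %| N * m2)%N by rewrite Nm dvdn_mull.
have uTA j y : (j <= J + J)%N -> u (N * m2 + j)%N y <= u (N * m2)%N y + A2.
  move=> jJ; rewrite /u divnDl// iterD.
  apply: (iter_step_le _ _ t0 (iter_step_lipb 0 _ t0 gr) gr) => z.
  by have := d2 _ _ z jJ gr; rewrite ler_norml => /andP[_]; lra.
have := chernoff_compare x e0 e1 h0 k0 qm ur gM' ustep uA u0A uTA Nh.
rewrite u0 /u Nm -/t => main; apply: le_trans main _.
rewrite -!addrA lerD2l.
have err : k%:R * A / (J.+1%:R ^+ 2 * h) <= A.
  have A0 : 0 <= A.
    by rewrite addr_ge0// mulr_ge0 ?divr_ge0 ?(ltW n0R) ?(ltW j00) ?(ltW r0) ?(ltW e0).
  rewrite JE natrM hE.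
  have -> : k%:R * A / ((k%:R * j0%:R) ^+ 2 * (n%:R^-1 / k%:R)) = A * (n%:R / j0%:R ^+ 2).
    by move: (A) => A'; field; rewrite !gt_eqF.
  rewrite ler_piMr// ler_pdivrMr ?exprn_gt0// mul1r -snn.
  by rewrite lerXn2r// nnegrE ltW.
(* By [sm] the coefficient is at most 2 e^4 (r / (24 e^3)) / e = r / 12. *)
have m4 : mom4 ((q%:R + m2%:R) * h * (r / e ^+ 3 / 24) / e) <= mom4 (r / 12).
  apply: mom4_le; rewrite [q%:R + _]addrC.
  rewrite (_ : r / 12 = 2 * e ^+ 4 * (r / e ^+ 3 / 24) / e); last first.
    by field; rewrite !gt_eqF.
  rewrite ler_pM2r ?invr_gt0// ler_pM2r// !divr_gt0// exprn_gt0//.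
have {}m4 : e * mom4 ((q%:R + m2%:R) * h * (r / e ^+ 3 / 24) / e) <= e * mom4 (r / 12).
  by rewrite ler_pM2l.
have Qe : 0 <= Q * e by rewrite mulr_ge0// ltW.
rewrite /A /A2 in err *.
have -> : 2 * j0%:R / n%:R * mom2 B = 2 * (j0%:R / n%:R * mom2 B) by rewrite !mulrA.
move: jQ err m4 Qe; set a1 := _ / _ * mom2 B; set a2 := k%:R * _ / _.
by set a3 := mom4 (_ / e); set a4 := mom4 (r / 12) => *; lra.
Qed.

End ConvexStep.

(** * The central limit theorem *)

Section Exponent.
Context {R : realType}.

(** The exponent solves e^(p+1) = n^(-1/2). As e <= 1 <= p, also e^p <= e, whence n^(-1) = (e^p e)^2
    <= e^4. *)
Lemma rate_exponent (p : R) (n : nat) : (0 < n)%N -> 1 <= p ->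
  let e := n%:R `^ (- (2 + 2 * p)^-1) in
  [/\ 0 < e <= 1, e `^ p * e = (Num.sqrt n%:R)^-1, e `^ p <= e & n%:R^-1 <= e ^+ 4].
Proof.
move=> n0 p1 e; have n0R : 0 < n%:R :> R by rewrite ltr0n.
have n1R : 1 <= n%:R :> R by rewrite ler1n.
have e0 : 0 < e by exact: powR_gt0.
have e1 : e <= 1.
  rewrite -[leRHS](powRr0 (n%:R : R)); apply: ler_powR => //.
  by rewrite oppr_le0 invr_ge0; lra.
have epe : e `^ p * e = (Num.sqrt n%:R)^-1.
  rewrite -[X in _ * X](powRr1 (ltW e0)) -powRD; last first.
    by rewrite (gt_eqF e0) implybT.
  rewrite /e -powRrM (_ : _ * _ = - 2^-1); last by field; rewrite gt_eqF//; lra.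
  by rewrite powRN powR12_sqrt// ltW.
have epl : e `^ p <= e.
  by rewrite -[leRHS](powRr1 (ltW e0)); apply: ger_powR => //; rewrite e0.
split => //; first by rewrite e0.
have -> : n%:R^-1 = (e `^ p * e) ^+ 2 :> R.
  by rewrite epe exprVn sqr_sqrtr// ltW.
have := powR_ge0 e p; move: epl; move: (e `^ p) => P Pe P0.
rewrite (_ : e ^+ 4 = (e * e) ^+ 2); last by ring.
by rewrite lerXn2r ?nnegrE ?mulr_ge0 ?(ltW e0)// ler_pM2r.
Qed.

Lemma powR_decay (c eps : R) : 0 < c -> 0 < eps ->
  \forall m \near \oo, m%:R `^ (- c) < eps.
Proof.
move=> c0 eps0; pose y := eps `^ (- c^-1).
have y0 : 0 < y by exact: powR_gt0.
exists (Num.truncn y).+1 => // m /= ym.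
have ym' : y < m%:R by apply: lt_le_trans (truncnS_gt y) _; rewrite ler_nat.
have -> : eps = y `^ (- c).
  by rewrite /y -powRrM mulrNN mulVf ?gt_eqF// powRr1// ltW.
rewrite !powRN ltf_pV2 ?posrE ?powR_gt0//; last exact: lt_trans ym'.
by apply: gt0_ltr_powR => //; rewrite nnegrE ltW//; exact: lt_trans ym'.
Qed.

End Exponent.

(** * Sequences with a Cauchy rate uniform in space *)

Section SequenceLimit.
Context {R : realType}.
Variables (U : nat -> R -> R) (e : nat -> R) (C : R).
Hypothesis C0 : 0 <= C.
Hypothesis e0 : forall eps, 0 < eps -> \forall m \near \oo, e m < eps.
Hypothesis UC : forall n m x, (0 < n)%N -> (0 < m)%N -> `|U n x - U m x| <= C * (e n + e m).

Lemma rate_small eps : 0 < eps -> \forall m \near \oo, C * e m < eps.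
Proof.
move=> eps0; have C1 : 0 < C + 1 by rewrite ltr_wpDl.
have eC : 0 < eps / (C + 1) by rewrite divr_gt0.
apply: filterS (e0 eC) => m; rewrite ltr_pdivlMr//.
have [h|h] := leP (e m) 0; first by move=> _; apply: le_lt_trans eps0; exact: mulr_ge0_le0.
by move=> q; lra.
Qed.

(** Only m tends to infinity, so [e m] disappears and the constant in front of [e n] is
    preserved. *)
Lemma rate_limit_dist (l x : R) n : (0 < n)%N -> U m x @[m --> \oo] --> l ->
  `|U n x - l| <= C * e n.
Proof.
move=> n0 Ul; apply/ler_addgt0Pr => eps eps0.
have eps2 : 0 < eps / 2 by lra.
have h1 : \forall m \near \oo, `|l - U m x| < eps / 2.
  exact: (@cvgr_dist_lt _ _ _ _ _ (fun m => U m x) l Ul _ eps2).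
have h2 := rate_small eps2.
have h3 : \forall m \near \oo, (0 < m)%N by exists 1%N.
have /filter_ex[m [q1 q2 q3]] : \forall m \near \oo,
    [/\ `|l - U m x| < eps / 2, C * e m < eps / 2 & (0 < m)%N].
  by apply: filterS3 h1 h2 h3 => m *; split.
have -> : U n x - l = (U n x - U m x) - (l - U m x) by ring.
apply: le_trans (ler_normB _ _) _; have := UC x n0 q3; rewrite mulrDr; lra.
Qed.

Lemma rate_cvg x : cvg (U m x @[m --> \oo]).
Proof.
apply: cauchy_cvg; apply: cauchy_exP => eps eps0.
have eps2 : 0 < eps / 2 by lra.
have [N _ hN] := rate_small eps2.
exists (U N.+1 x); exists N.+1 => // m /= Nm.
have mp : (0 < m)%N by exact: leq_trans Nm.
rewrite /ball/=; apply: le_lt_trans (UC x (ltn0Sn N) mp) _.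
have := hN m (ltnW Nm); have := hN N.+1 (leqnSn N); rewrite /= mulrDr; lra.
Qed.

Lemma rate_family_cvg : {family compact, U @ \oo --> (fun x => lim (U m x @[m --> \oo]))}.
Proof.
apply/fam_cvgP => A _ P /uniform_nbhs[E [entE sub]].
move: entE; rewrite -entourage_ballE => -[eps /= eps0 bE].
have h2 := rate_small eps0.
have h3 : \forall m \near \oo, (0 < m)%N by exists 1%N.
apply: filterS2 h2 h3 => m Cm m0; apply: sub => y _; apply: bE.
rewrite /ball/= distrC; apply: le_lt_trans Cm; apply: rate_limit_dist => //.
exact: rate_cvg.
Qed.

End SequenceLimit.

(** * Sums of iid variables and the rate for the discrete evolutions *)

Section CentralLimit.
Context {R : realType} {Omega : Type}.
Variables (H : set (Omega -> R)) (E : (Omega -> R) -> R) (xi : nat -> Omega -> R).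
Hypothesis hE : convex_expectation_space H E.
Hypothesis hxi : forall n, H (xi n).
Hypothesis xi_iid : iid E xi.
Hypothesis xi_H2 : H (fun w => `|xi 0%N w| ^+ 2).
Hypothesis xi_H3 : H (fun w => xi 0%N w ^+ 3).
Hypothesis xi_H4 : H (fun w => xi 0%N w ^+ 4).
Hypothesis xi_mean0 : forall b : R, E (fun w => b * xi 0%N w) = 0.
Hypothesis xi_skew0 : forall c : R, E (fun w => c * xi 0%N w ^+ 3) = 0.

Let D : set (R -> R) := [set phi | H (fun w => phi (xi 0%N w))].
Let L (phi : R -> R) : R := E (fun w => phi (xi 0%N w)).

Lemma xi_law : convex_law D L.
Proof.
split; rewrite /D /L /=.
- by move=> c; exact: ces_cst hE c.
- by move=> c X Y dX dY; exact: (ces_lin hE c dX dY).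
- move=> g [cg [M [Mr gM]]].
  have Cf : Cb 'rV[R]_1 (fun v => g (v ord0 ord0)).
    split; last by exists M; split=> // m Mm v _; exact: gM.
    move=> v; apply: (@continuous_comp _ _ _ (fun v : 'rV[R]_1 => v ord0 ord0) g).
      exact: coord_continuous.
    exact: cg.
  have := ces_comp hE Cf (fun _ => hxi 0%N).
  by congr H; apply/funext => w; rewrite mxE.
- exact: hxi.
- by have := xi_H2; congr H; apply/funext => w; rewrite real_normK// num_real.
- exact: xi_H3.
- exact: xi_H4.
- by move=> X Y dX dY XY; apply: (ces_mono hE dX dY) => w; exact: XY.
- by move=> l X Y l01 dX dY; exact: (ces_convex hE l01 dX dY).
- by move=> c; exact: (ces_Ecst hE).
- exact: xi_mean0.
- exact: xi_skew0.
Qed.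

Lemma chernoff_stepE t : t != 0 -> chernoff_step E (xi 0%N) t = step L t 0.
Proof.
move=> t0; apply/funext => g; apply/funext => x.
rewrite /chernoff_step (negbTE t0) /step /L.
by congr (_ * E _); apply/funext => w; rewrite mul0r addr0.
Qed.

Lemma lipb_Cb_comp (T : topologicalType) r (g : R -> R) (c : R) (h : T -> R) :
  lipb r g -> continuous h -> Cb T (fun v => c * g (h v)).
Proof.
move=> gr ch; split.
  move=> v; apply: cvgM; first exact: cvg_cst.
  apply: (@continuous_comp _ _ _ h g); first exact: ch.
  exact: lipb_continuous gr _.
have [_ [M gM]] := gr; exists (`|c| * M); split; first exact: num_real.
move=> m Mm v _; apply: le_trans (ltW Mm); rewrite normrM.
by apply: ler_wpM2l.
Qed.

(** Allowing k steps already performed makes the induction on m work: independence integrates out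
    the last summand, which adds one step to [G k]. The factor n stays inside E, as in the step
    itself, because E is not homogeneous. *)
Lemma iid_sum_step r (g : R -> R) (n k m : nat) : (0 < n)%N -> lipb r g ->
  let G k := iter k (step L n%:R^-1 0) g in
  E (fun w => n%:R * G k ((Num.sqrt n%:R)^-1 * \sum_(i < m) xi i w)) =
  n%:R * G (k + m)%N 0.
Proof.
move=> n0 gr G; have n0R : 0 < n%:R :> R by rewrite ltr0n.
have t0 : 0 < n%:R^-1 :> R by rewrite invr_gt0.
have Gr j : lipb r (G j) by exact: (iter_step_lipb xi_law 0 j t0 gr).
set c := (Num.sqrt n%:R)^-1.
have GE j x : n%:R * G j.+1 x = E (fun w => n%:R * G j (x + c * xi 0%N w)).
  rewrite /G iterS -/(G j) /step mulrA divff ?gt_eqF// mul1r /L.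
  congr E; apply/funext => w; rewrite invrK mul0r addr0 sqrtrV//; exact: ltW.
elim: m k => [|m ih] k.
  rewrite addn0 -[RHS](ces_Ecst hE); congr E; apply/funext => w.
  by rewrite big_ord0 mulr0.
(* Independence is stated for a nonempty vector of earlier variables, so a single summand is treated
   apart. *)
rewrite addnS -addSn -ih; case: m {ih} => [|m].
  rewrite -[RHS](_ : n%:R * G k.+1 0 = _); last first.
    rewrite -[LHS](ces_Ecst hE); congr E; apply/funext => w.
    by rewrite big_ord0 mulr0.
  rewrite GE; congr E; apply/funext => w.
  by rewrite big_ord_recl big_ord0 addr0 add0r.
pose F (v : 'rV[R]_(m.+1 + 1)) := n%:R * G k (c * \sum_i v ord0 i).
have CF : Cb _ F.
  apply: (lipb_Cb_comp _ (Gr k)) => v.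
  apply: (@continuous_comp _ _ _ (fun v : 'rV[R]_(m.+1 + 1) => \sum_i v ord0 i) ( *%R c)).
    apply: continuous_big => [|i _]; first exact: add_continuous.
    exact: coord_continuous.
  exact: mulrl_continuous.
have := xi_iid.2 m F CF.
have Fsum (w w' : Omega) : F (row_mx (\row_(i < m.+1) xi i w) (const_mx (xi m.+1 w'))) =
    n%:R * G k (c * (\sum_(i < m.+1) xi i w + xi m.+1 w')).
  rewrite /F big_split_ord/= big_ord1 row_mxEr mxE; congr (_ * G k (_ * (_ + _))).
  by apply: eq_bigr => i _; rewrite row_mxEl mxE.
rewrite (_ : (fun w => F _) = fun w => n%:R * G k (c * \sum_(i < m.+2) xi i w)); last first.
  by apply/funext => w; rewrite Fsum [in RHS]big_ord_recr.
move=> ->; congr E; apply/funext => w; rewrite GE.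
transitivity (E (fun w' => n%:R * G k (c * (\sum_(i < m.+1) xi i w + xi m.+1 w')))).
  by congr E; apply/funext => w'; rewrite Fsum.
have Cg : Cb _ (fun y => n%:R * G k (c * (\sum_(i < m.+1) xi i w + y))).
  apply: (lipb_Cb_comp _ (Gr k)) => y; apply: cvgM; first exact: cvg_cst.
  by apply: cvgD; [exact: cvg_cst|exact: cvg_id].
rewrite (xi_iid.1 m.+1 _ Cg); congr E; apply/funext => w'.
by rewrite mulrDr.
Qed.

Section Rate.
Variables (a p : R).
Hypothesis a_ge0 : 0 <= a.
Hypothesis p_ge1 : 1 <= p.
Hypothesis xi_scaling : forall c1 c2 l : R, 0 <= c1 -> 0 <= c2 -> 1 <= l ->
  E (fun w => l * (c1 * `|xi 0%N w| ^+ 2 + c2 * `|xi 0%N w| ^+ 3))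
  <= a * l `^ p * E (fun w => c1 * `|xi 0%N w| ^+ 2 + c2 * `|xi 0%N w| ^+ 3).
Variables (r : R) (f : R -> R).
Hypothesis r_ge1 : 1 <= r.
Hypothesis fr : lipb r f.
Hypothesis f_le : forall x, `|f x| <= r.

Let e (n : nat) : R := n%:R `^ (- (2 + 2 * p)^-1).
Let U (n : nat) : R -> R := iter n (step L n%:R^-1 0) f.
Let Q : R := a * mom2 L 2^-1 * r `^ p.

Lemma mom2_abs c : mom2 L c = E (fun w => c * `|xi 0%N w| ^+ 2).
Proof.
by rewrite /mom2 /L; congr E; apply/funext => w; rewrite real_normK// num_real.
Qed.

Lemma mom2_scaling c l : 0 <= c -> 1 <= l -> mom2 L (l * c) <= a * l `^ p * mom2 L c.
Proof.
move=> c0 l1; have := xi_scaling c0 (lexx 0) l1; rewrite !mom2_abs.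
rewrite (_ : (fun w => l * _) = (fun w => l * c * `|xi 0%N w| ^+ 2)); last first.
  by apply/funext => w; rewrite mul0r addr0 mulrA.
rewrite (_ : (fun w => c * _ + _) = (fun w => c * `|xi 0%N w| ^+ 2))//.
by apply/funext => w; rewrite mul0r addr0.
Qed.

Lemma chernoff_rate n k x : (0 < n)%N -> (0 < k)%N ->
  `|U n x - U (n * k)%N x| <= (8 * r + 3 * Q + mom4 L (r / 12)) * e n.
Proof.
move=> n0 k0; have r1 := r_ge1; have p1 := p_ge1.
have [/andP[e0 e1] epe epl ne] := rate_exponent n0 p_ge1.
rewrite -/(e n) in e0 e1 epe epl ne *.
have n0R : 0 < n%:R :> R by rewrite ltr0n.
have nk0 : 0 < (n * k)%:R^-1 :> R by rewrite invr_gt0 ltr0n muln_gt0 n0.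
have m2 : 0 <= mom2 L 2^-1 by apply: (mom2_ge0 xi_law); rewrite invr_ge0.
have Q0 : 0 <= Q by rewrite /Q !mulr_ge0 ?powR_ge0.
have m4 : 0 <= mom4 L (r / 12) by apply: (mom4_ge0 xi_law); lra.
(* If e >= 1/4 the bound is trivial: two functions bounded by r differ by at most 2 r <= 8 r e. *)
have [e4|e4] := leP 4^-1 (e n).
  have u1 : `|U n x| <= r.
    by apply: (iter_step_bound xi_law n x _ fr f_le); rewrite invr_gt0.
  have u2 : `|U (n * k)%N x| <= r by apply: (iter_step_bound xi_law (n * k) x nk0 fr f_le).
  apply: le_trans (ler_normB _ _) _; apply: le_trans (lerD u1 u2) _.
  set c := 8 * r + _ + _; have : 8 * r <= c by rewrite /c; lra.
  by have := ler_pM2r e0; move=> h rc; have : c * 4^-1 <= c * e n; [apply: ler_wpM2l => //; lra|lra].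
(* r / (4 e) is l / 2 with l = r / (2 e) >= 1. Scaling produces l^p <= r^p / (2 e^p), because 2^p >=
   2, and n^(-1/2) = e^p e cancels e^p. *)
have hQ : (Num.sqrt n%:R)^-1 * mom2 L (r / (4 * e n)) <= e n * (Q / 2).
  pose l := r / (2 * e n).
  have l1 : 1 <= l by rewrite /l ler_pdivlMr ?mul1r//; lra.
  rewrite (_ : r / (4 * e n) = l * 2^-1); last by rewrite /l; field; rewrite gt_eqF.
  have h20 : 0 <= (2^-1 : R) by rewrite invr_ge0.
  have ms := mom2_scaling h20 l1.
  have P0 : 0 < e n `^ p by exact: powR_gt0.
  have lp : l `^ p <= r `^ p / (2 * e n `^ p).
    have hr : 0 <= r by lra.
    have he : 0 <= 2 * e n by lra.
    have h2p : 2 <= 2 `^ p :> R.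
      by rewrite -[leLHS](@powRr1 _ 2)//; apply: ler_powR => //; lra.
    rewrite -(mulfK (_ : (2 * e n) `^ p != 0) (l `^ p)); last first.
      by rewrite gt_eqF// powR_gt0// mulr_gt0.
    rewrite -powRM//; last by rewrite /l divr_ge0.
    rewrite (_ : l * (2 * e n) = r); last by rewrite /l divfK// gt_eqF// mulr_gt0.
    apply: ler_wpM2l; first exact: powR_ge0.
    rewrite powRM// ?(ltW e0)// lef_pV2 ?posrE ?mulr_gt0 ?powR_gt0//.
    by rewrite ler_pM2r.
  rewrite -epe -mulrA; apply: (@le_trans _ _ (e n `^ p * (e n * (a * (r `^ p / (2 * e n `^ p)) * mom2 L 2^-1)))).
    apply: ler_wpM2l; first exact: ltW.
    apply: ler_wpM2l; first exact: ltW.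
    apply: le_trans ms _; apply: ler_wpM2r => //; exact: ler_wpM2l.
  by rewrite le_eqVlt /Q; apply/orP; left; apply/eqP; field; rewrite gt_eqF.
have e14 : 0 < e n < 4^-1 by rewrite e0.
have knk : k%:R / (n * k)%:R = n%:R^-1 :> R.
  by rewrite natrM; field; rewrite !gt_eqF// ltr0n.
have U1 : iter (n * k) (step L (1%:R / (n * k)%:R) 0) f = U (n * k)%N by rewrite /U mul1r.
have U2 : iter n (step L (k%:R / (n * k)%:R) 0) f = U n by rewrite knk.
have A1 := chernoff_rate_one_sided xi_law x r_ge1 e14 n0 k0 ne Q0 hQ
  (or_introl (conj erefl erefl)) (muln1 _) fr f_le.
have A2 := chernoff_rate_one_sided xi_law x r_ge1 e14 n0 k0 ne Q0 hQ
  (or_intror (conj erefl erefl)) erefl fr f_le.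
rewrite mulnK// U1 U2 in A1; rewrite divn1 U1 U2 in A2.
rewrite ler_norml lerNl opprB !lerBlDl; apply/andP.
by split; [exact: A1|exact: A2].
Qed.

(** At l = 1 scaling reads mom2 c <= a mom2 c, so all second moments vanish. The barriers then cost
    only r^2 / (4 B), and B is arbitrarily large. *)
Lemma chernoff_iter_id n x : a < 1 -> (0 < n)%N -> U n x = f x.
Proof.
move=> a1 n0; have t0 : 0 < n%:R^-1 :> R by rewrite invr_gt0 ltr0n.
have mom20 c : 0 <= c -> mom2 L c = 0.
  move=> c0; have := mom2_scaling c0 (lexx 1); rewrite mul1r powR1 mulr1.
  have := mom2_ge0 xi_law c0; nra.
apply/eqP; rewrite -subr_eq0 -normr_eq0 eq_le normr_ge0 andbT.
apply: (@ler_invS_limit _ _ _ (r ^+ 2 / 4)) => N; rewrite add0r.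
have B0 : 0 < N.+1%:R :> R by rewrite ltr0n.
have := iter_step_dist xi_law n x t0 B0 fr.
rewrite (mom20 _ (ltW B0)) mulr0 addr0 => /le_trans; apply.
by rewrite invfM mulrA.
Qed.

End Rate.
End CentralLimit.

(** * Comparison with the stated constants *)

Section Constants.
Context {R : realType} {Omega : Type}.
Variables (H : set (Omega -> R)) (E : (Omega -> R) -> R) (X : Omega -> R).
Let D : set (R -> R) := [set phi | H (fun w => phi (X w))].
Let L (phi : R -> R) : R := E (fun w => phi (X w)).
Hypothesis cl : convex_law D L.
Variables (a p r : R) (b : nat -> nat -> R).

(* c_minus and c_plus are the cases c = c_lip + r and c = 2 c_lip + r. *)
Definition rate_constant (c : R) : R :=
  8 * r + 3 * a * E (fun w => 2^-1 * `|X w| ^+ 2) * b 0 1 `^ p * r `^ p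
  + 2 * a * E (fun w => 2^-1 * r * b 0 1 * `|X w| ^+ 2)
  + a * E (fun w => 24^-1 * r * b 0 3 * `|X w| ^+ 4
                    + 2^-1 * r * b 0 1 * `|X w| ^+ 2)
  + E (fun w => 2^-1 * (c * b 1 2 + r * b 0 1) * `|X w| ^+ 2)
  + 2^-1 * c * b 2 0.

Lemma abs_mom2 k : E (fun w => k * `|X w| ^+ 2) = mom2 L k.
Proof.
by rewrite /mom2 /L; congr E; apply/funext => w; rewrite real_normK// num_real.
Qed.

Lemma abs_mom42 k l : E (fun w => k * `|X w| ^+ 4 + l * `|X w| ^+ 2) =
  L (fun y => k * y ^+ 4 + l * y ^+ 2).
Proof.
rewrite /L; congr E; apply/funext => w.
by rewrite -[_ ^+ 4]normrX -[`|_| ^+ 2]normrX !ger0_norm ?exprn_even_ge0.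
Qed.

Lemma mom4_le_mom42 k l k' : k' <= k -> 0 <= l ->
  mom4 L k' <= L (fun y => k * y ^+ 4 + l * y ^+ 2).
Proof.
move=> kk l0; apply: (cl_mono cl (mom4_D cl _) (law_add cl (mom4_D cl k) (mom2_D cl l))).
move=> y; rewrite -[leLHS]addr0; apply: lerD; last by rewrite mulr_ge0 ?sqr_ge0.
by apply: ler_wpM2r => //; exact: exprn_even_ge0.
Qed.

Hypotheses (a0 : 0 <= a) (p1 : 1 <= p) (r1 : 1 <= r) (b01 : 1 <= b 0 1)
  (b03 : 6 <= b 0 3) (b12 : 0 <= b 1 2) (b20 : 0 <= b 2 0).

Lemma rate_constant_tail c : 0 <= c ->
  8 * r + 3 * (a * mom2 L 2^-1 * (b 0 1 `^ p * r `^ p)) + a * mom4 L (r / 12) <=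
  rate_constant c.
Proof.
move=> c0; have r0 : 0 <= r by apply: le_trans r1.
have b0 : 0 <= b 0 1 by apply: le_trans b01.
have h2 : 0 <= (2^-1 : R) by rewrite invr_ge0.
have hb : 0 <= 2^-1 * r * b 0 1 by rewrite !mulr_ge0.
rewrite /rate_constant !abs_mom2 abs_mom42.
(* Here b_{0,3} >= 6 enters: r b_{0,3} / 24 >= r / 4 >= r / 12. *)
have m4 : mom4 L (r / 12) <= L (fun y => 24^-1 * r * b 0 3 * y ^+ 4 + 2^-1 * r * b 0 1 * y ^+ 2).
  apply: mom4_le_mom42 => //; have := ler_wpM2l r0 b03; lra.
have k1 := ler_wpM2l a0 m4.
have k2 : 0 <= 2 * a * mom2 L (2^-1 * r * b 0 1).
  by apply: mulr_ge0; [rewrite mulr_ge0|exact: (mom2_ge0 cl)].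
have k3 : 0 <= mom2 L (2^-1 * (c * b 1 2 + r * b 0 1)).
  by apply: (mom2_ge0 cl); apply: mulr_ge0 => //; apply: addr_ge0; apply: mulr_ge0.
have k4 : 0 <= 2^-1 * c * b 2 0 by rewrite !mulr_ge0.
rewrite -!mulrA in k1 k2 k3 k4 *; move: k1 k2 k3 k4.
by set A1 := a * L _; set A2 := a * mom4 L _ => *; lra.
Qed.

Lemma rate_constant_ge0 c : 0 <= c -> 0 <= rate_constant c.
Proof.
move=> c0; apply: le_trans (rate_constant_tail c0).
have r0 : 0 <= r by apply: le_trans r1.
have m2 : 0 <= mom2 L 2^-1 by apply: (mom2_ge0 cl); rewrite invr_ge0.
have m4 : 0 <= mom4 L (r / 12) by apply: (mom4_ge0 cl); rewrite divr_ge0.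
by rewrite !addr_ge0// !mulr_ge0// ?mulr_ge0 ?powR_ge0.
Qed.

(** The factor a >= 1 covers the quartic moment, and b_{0,1}^p >= 1 covers the second moment
    term. *)
Lemma rate_constant_ge c : 1 <= a -> 0 <= c ->
  8 * r + 3 * (a * mom2 L 2^-1 * r `^ p) + mom4 L (r / 12) <= rate_constant c.
Proof.
move=> a1 c0; apply: le_trans (rate_constant_tail c0).
have m2 : 0 <= mom2 L 2^-1 by apply: (mom2_ge0 cl); rewrite invr_ge0.
have m4 : 0 <= mom4 L (r / 12).
  by apply: (mom4_ge0 cl); rewrite divr_ge0//; apply: le_trans r1.
apply: lerD; last by rewrite ler_peMl.
rewrite lerD2l ler_pM2l//; apply: ler_wpM2l; first exact: mulr_ge0.
rewrite ler_peMl ?powR_ge0// -(powRr0 (b 0 1)); apply: ler_powR => //.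
exact: le_trans p1.
Qed.

End Constants.

(** * Existence of the limit and the final estimate *)

Unset Implicit Arguments.

Theorem theorem4p7 (R : realType) (Omega : Type)
    (H : set (Omega -> R)) (E : (Omega -> R) -> R)
    (xi : nat -> Omega -> R) (eta : R * R -> R) (a p : R)
    (hE : convex_expectation_space H E)
    (hxi : forall n, H (xi n))
    (xi_iid : iid E xi)
    (xi_H2 : H (fun w => `|xi 0%N w| ^+ 2))
    (xi_H3 : H (fun w => xi 0%N w ^+ 3))
    (xi_H4 : H (fun w => xi 0%N w ^+ 4))
    (xi_mean0 : forall b : R, E (fun w => b * xi 0%N w) = 0)
    (xi_ui : E (fun w => Num.max (`|xi 0%N w| ^+ 2 - c) 0) @[c --> +oo] --> 0)
    (a_ge0 : 0 <= a) (p_ge1 : 1 <= p)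
    (xi_scaling : forall c1 c2 l : R, 0 <= c1 -> 0 <= c2 -> 1 <= l ->
       E (fun w => l * (c1 * `|xi 0%N w| ^+ 2 + c2 * `|xi 0%N w| ^+ 3))
       <= a * l `^ p *
          E (fun w => c1 * `|xi 0%N w| ^+ 2 + c2 * `|xi 0%N w| ^+ 3))
    (xi_skew0 : forall c : R, E (fun w => c * xi 0%N w ^+ 3) = 0)
    (eta_mollifier : mollifier eta) :
  forall (r : R) (f : R -> R) (n : nat),
    1 <= r -> Lip_b r f -> (0 < n)%N ->
    let b := kernel_norm eta in
    let gamma := (2 + 2 * p)^-1 in
    - c_minus E (xi 0%N) b a p r * n%:R `^ (- gamma)
      <= n%:R^-1 *
         E (fun w => n%:R * f ((Num.sqrt n%:R)^-1 * \sum_(i < n) xi i w))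
         - E_zeta E (xi 0%N) f
      <= c_plus E (xi 0%N) b a p r * n%:R `^ (- gamma).
Proof.
move=> r f n r1 fL n0; cbv zeta; set b := kernel_norm eta; set gamma := (2 + 2 * p)^-1.
have [flip fb] : r.-lipschitz_setT f /\ forall x, `|f x| <= r by exact: fL.
have fr : lipb r f.
  by split; [move=> x y; exact: (flip (x, y))|exists r].
have cl := xi_law hE hxi xi_H2 xi_H3 xi_H4 xi_mean0 xi_skew0.
set X := xi 0%N in cl *.
pose L (phi : R -> R) : R := E (fun w => phi (X w)).
pose S (m : nat) := iter m (step L m%:R^-1 0) f.
pose e (m : nat) : R := m%:R `^ (- gamma).
(* For a < 1 all [S m] with m > 0 equal f, so the rate holds with constant 0. *)
pose C := if 1 <= a then 8 * r + 3 * (a * mom2 L 2^-1 * r `^ p) + mom4 L (r / 12) else 0.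
have r0 : 0 <= r by lra.
have K0 : 0 <= mom2 L 2^-1 by apply: (mom2_ge0 cl); rewrite invr_ge0.
have M4 : 0 <= mom4 L (r / 12) by apply: (mom4_ge0 cl); rewrite divr_ge0.
have C0 : 0 <= C.
  rewrite /C; case: ifP => // _.
  by rewrite !addr_ge0// !mulr_ge0// ?powR_ge0.
have rate m k x : (0 < m)%N -> (0 < k)%N -> `|S m x - S (m * k)%N x| <= C * e m.
  move=> m0 k0; rewrite /C; case: ifPn => [a1|].
    exact: (chernoff_rate hE hxi xi_H2 xi_H3 xi_H4 xi_mean0 xi_skew0 a_ge0 p_ge1
      xi_scaling r1 fr fb).
  rewrite -ltNge => a1.
  have id l : (0 < l)%N -> S l x = f x.
    exact: (chernoff_iter_id hE hxi xi_H2 xi_H3 xi_H4 xi_mean0 xi_skew0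
      xi_scaling fr x a1).
  by rewrite !id ?muln_gt0 ?m0// subrr normr0 mul0r.
(* The sequence whose limit defines S(1) f. At m = 0 it performs no step; it agrees with [S] from m
   = 1 on. *)
pose U (m : nat) := iter (Num.truncn (m%:R * 1 : R)) (chernoff_step E X m%:R^-1) f.
have US m : (0 < m)%N -> U m = S m.
  move=> m0; rewrite /U /S mulr1 natrK; congr (iter _ _ _).
  by rewrite /X chernoff_stepE// invr_neq0// pnatr_eq0 -lt0n.
have Ub m x : `|U m x| <= r.
  have [->|m0] := posnP m; first by rewrite /U mul0r truncn0.
  rewrite US//; apply: (iter_step_bound cl _ _ _ fr fb).
  by rewrite invr_gt0 ltr0n.
have UC m k x : (0 < m)%N -> (0 < k)%N -> `|U m x - U k x| <= C * (e m + e k).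
  move=> m0 k0; rewrite !US// mulrDr.
  have -> : S m x - S k x = (S m x - S (m * k)%N x) - (S k x - S (k * m)%N x).
    by rewrite [(k * m)%N]mulnC; ring.
  by apply: le_trans (ler_normB _ _) _; apply: lerD; exact: rate.
have gamma0 : 0 < gamma by rewrite invr_gt0; lra.
have e0 eps : 0 < eps -> \forall m \near \oo, e m < eps by exact: powR_decay.
pose g x := lim (U m x @[m --> \oo]).
have Ug x : U m x @[m --> \oo] --> g x by exact: (rate_cvg C0 e0 UC).
have Ulip m x y : `|U m x - U m y| <= r * `|x - y|.
  have [->|m0] := posnP m; first by rewrite /U mul0r truncn0; exact: lipb_dist fr _ _.
  rewrite US//; apply: (lipb_dist (iter_step_lipb cl 0 m _ fr)).
  by rewrite invr_gt0 ltr0n.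
have gr : lipb r g.
  split=> [x y|].
    have h : `|U m x - U m y| @[m --> \oo] --> `|g x - g y|.
      by apply: cvg_norm; apply: cvgB; exact: Ug.
    rewrite -(cvg_lim _ h)//; apply: limr_le; first by apply/cvg_ex; eexists; exact: h.
    by apply: nearW => m; exact: Ulip.
  exists r => x; have h : `|U m x| @[m --> \oo] --> `|g x| by apply: cvg_norm; exact: Ug.
  rewrite -(cvg_lim _ h)//; apply: limr_le; first by apply/cvg_ex; eexists; exact: h.
  by apply: nearW => m; exact: Ub.
have gCb : Cb _ g.
  split; first exact: lipb_continuous gr.
  have [_ [M gM]] := gr; exists M; split; first exact: num_real.
  by move=> m Mm x _; apply: le_trans (gM x) (ltW Mm).
(* [chernoff_limit] selects a limit by choice, so one has to be exhibited first. The selected limit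
   is not identified with [g]: its convergence at 0 is enough. *)
have ex : exists g0, Cb _ g0 /\ mixed_cvg U g0.
  exists g; split => //; split; first by exists r.
  exact: (rate_family_cvg C0 e0 UC).
have [_ [_ Uz]] := getPex ex.
have {}Uz : U m 0 @[m --> \oo] --> E_zeta E X f.
  by move/pointwise_cvg_compact_family/pointwise_cvgP : Uz; exact.
have dist := rate_limit_dist C0 e0 UC n0 Uz.
have n0R : n%:R != 0 :> R by rewrite pnatr_eq0 -lt0n.
have sumE : n%:R^-1 * E (fun w => n%:R * f ((Num.sqrt n%:R)^-1 * \sum_(i < n) xi i w)) = U n 0.
  have := iid_sum_step hE hxi xi_iid xi_H2 xi_H3 xi_H4 xi_mean0 xi_skew0 0 n n0 fr.
  by rewrite /= => ->; rewrite add0n mulKf// US.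
rewrite sumE; move: dist; rewrite ler_norml => /andP[lo up].
have b01 := kernel_norm01_ge1 eta_mollifier.
have b03 := kernel_norm03_ge6 eta_mollifier.
have b12 := kernel_norm_ge0 eta 1 2.
have b20 := kernel_norm_ge0 eta 2 0.
have cl0 : 0 <= c_lip E X b a p r.
  rewrite /c_lip addr_ge0// !mulr_ge0// ?powR_ge0//.
  by move: K0; rewrite /mom2 /L; congr (0 <= E _); apply/funext => w;
    rewrite real_normK// num_real.
have Cle c : 0 <= c -> C <= rate_constant E X a p r b c.
  move=> c0; rewrite /C; case: ifPn => [a1|_].
    exact: (rate_constant_ge cl a_ge0 p_ge1 r1 b01 b03 b12 b20 a1 c0).
  exact: (rate_constant_ge0 cl p a_ge0 r1 b01 b03 b12 b20 c0).
have en : 0 <= e n by exact: powR_ge0.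
have Cm : C <= c_minus E X b a p r := Cle _ (addr_ge0 cl0 r0).
have Cp : C <= c_plus E X b a p r.
  exact: Cle _ (addr_ge0 (mulr_ge0 (ler0n _ 2) cl0) r0).
rewrite -/(e n); apply/andP; split.
  by apply: le_trans lo; rewrite mulNr lerN2; exact: ler_wpM2r.
by apply: le_trans up _; exact: ler_wpM2r.
Qed.
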